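(* Suppose $0<b<\frac12$ and $0<c<\frac13(1-4b^2)$. There is a number $N_0=N_0(b,c)$ such that the following holds for every real $N\ge N_0$ and every real $s\ge1$ with \[ s\le\exp\left(b\sqrt{\log N\,\log\log N}\right). \] Suppose $C$ is a residue system with $S(C)$ consisting of integers $n>N$, each having multiplicity at most $s$, and such that \[ \sum_{n\in S(C)}\frac1n\le c\,\log L(N,s). \] Then $\delta(C)>0$.
   Context: A residue system is a finite set $C$ of ordered pairs of positive integers $(n,r)$, each interpreted as the residue class $r\pmod n$. $S(C)$ is the multiset of the moduli $n$ appearing in $C$ (with $n$ repeated once for each pair $(n,r)\in C$); the multiplicity of $n$ is the number of times it appears in $S(C)$, and sums over $n\in S(C)$ count $n$ with multiplicity. $R(C)$ is the set of integers not congruent to $r\pmod n$ for any $(n,r)\in C$, and $\delta(C)$ is the asymptotic density of $R(C)$ (which exists, since $R(C)$ is a union of residue classes modulo the least common multiple of the moduli). Also \[ L(N,s)=\exp\left(\log N\,\frac{\log\log(s\log N)}{\log(s\log N)}\right). \] *)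

(* Defs.v *)
From mathcomp Require Import all_boot all_order all_algebra.
From mathcomp Require Import finmap multiset ring lra.
From mathcomp Require Import boolp classical_sets functions cardinality.
From mathcomp Require Import set_interval reals topology normedtype sequences exp.

Set Implicit Arguments.
Unset Strict Implicit.
Unset Printing Implicit Defensive.

Import Order.TTheory GRing.Theory Num.Theory.
Import numFieldNormedType.Exports.

Local Open Scope classical_set_scope.
Local Open Scope ring_scope.

(* A pair [(n, r)] stands for the residue class [r mod n].  [r] is any positive
   integer, so distinct pairs may represent the same class. *)
Definition residue_system (C : {fset nat * nat}) : Prop :=
  forall p, p \in C -> (0 < p.1)%N /\ (0 < p.2)%N.

Definition moduli (C : {fset nat * nat}) : {mset nat}%mset :=
  seq_mset [seq p.1 | p <- C].

Definition uncovered (C : {fset nat * nat}) : set int :=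
  [set m | forall p, p \in C -> (m != p.2%:Z %[mod p.1%:Z])%Z].

(* Density of a set of integers along the symmetric windows [-n, n], each of
   which contains 2n + 1 integers. *)
Definition density_seq (R : realType) (A : set int) (n : nat) : R :=
  #|` fset_set (A `&` `[(- n%:Z), n%:Z]) |%:R / (n.*2.+1)%:R.

(* [lim] is a default value for a sequence that does not converge; for the sets
   [uncovered C] the limit exists, see [cvg_density_uncovered]. *)
Definition density (R : realType) (A : set int) : R :=
  limn (density_seq R A).

Definition delta (R : realType) (C : {fset nat * nat}) : R :=
  density R (uncovered C).

Definition Lfun (R : realType) (N s : R) : R :=
  expR (ln N * (ln (ln (s * ln N)) / ln (s * ln N))).

Lemma card_window (A : set int) (n : nat) :
  #|` fset_set (A `&` `[(- n%:Z), n%:Z]) |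
    = (\sum_(0 <= k < n.*2.+1) `[< A (k%:Z - n%:Z)%R >])%N.
Proof.
pose s : seq int := [seq k%:Z - n%:Z | k <- index_iota 0 n.*2.+1].
have s_uniq : uniq s.
  by rewrite map_inj_uniq ?iota_uniq// => i j /addIr [].
have mem_s (m : int) : (m \in s) = (- n%:Z <= m <= n%:Z).
  apply/mapP/idP => [[k + ->]|/andP[lo hi]].
    rewrite mem_index_iota ltnS -addnn => /andP[_ kn].
    by rewrite lerBrDr addNr lez_nat leq0n/= lerBlDr -PoszD lez_nat.
  have m0 : 0 <= m + n%:Z by rewrite -lerBlDr sub0r.
  exists (absz (m + n%:Z)); last by rewrite gez0_abs// addrK.
  rewrite mem_index_iota leq0n ltnS -addnn -lez_nat gez0_abs//.
  by rewrite PoszD lerD2r.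
have -> : fset_set (A `&` `[(- n%:Z), n%:Z])
    = [fset m in [seq m <- s | `[< A m >]]]%fset.
  have fin : finite_set (A `&` `[(- n%:Z), n%:Z]).
    apply: (@sub_finite_set _ _ [set` s]); last exact: finite_seq.
    by move=> m [_ /=]; rewrite in_itv/= mem_s.
  apply/fsetP => m; rewrite in_fset_set// in_fset mem_filter; apply/idP/idP.
    rewrite inE => -[Am /=]; rewrite in_itv/= => mn.
    by rewrite mem_s mn andbT; apply/asboolP.
  case/andP => /asboolP Am ms; rewrite inE; split => //=.
  by rewrite in_itv/= -mem_s.
rewrite card_fseq undup_id ?filter_uniq// size_filter.
by rewrite -sum1_count big_mkcond/= big_map; apply: eq_bigr => k _; case: ifP.
Qed.

Lemma cvg_density_periodic (R : realType) (A : set int) (L : nat) :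
  (0 < L)%N -> (forall m, A (m + L%:Z) <-> A m) ->
  cvgn (@density_seq R A).
Proof.
move=> L0 A_per; pose a (m : int) : nat := `[< A m >].
have a_per m : a (m + L%:Z) = a m.
  by rewrite /a; congr nat_of_bool; apply: asbool_equiv_eq.
have a_perN m (q : nat) : a (m + (q * L)%N%:Z) = a m.
  elim: q => [|q IH]; first by rewrite mul0n addr0.
  by rewrite mulSn addnC PoszD addrA a_per.
pose W m := (\sum_(0 <= k < L) a (m + k%:Z)%R)%N.
have W_S m : W (m + 1) = W m.
  rewrite /W; case: (L) L0 a_per => // l _ a_per.
  rewrite big_nat_recr//= [RHS]big_nat_recl//= addnC; congr addn.
    by rewrite [in RHS]addr0 -(a_per m) -addrA -PoszD add1n.
  by apply: eq_bigr => k _; rewrite -addrA -PoszD add1n.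
have W_N (n : nat) : W (- n%:Z) = W 0.
  elim: n => [|n IH]; first by rewrite oppr0.
  by rewrite -IH -(W_S (- n.+1%:Z)) -addn1 PoszD opprD subrK.
have block m (q : nat) : (\sum_(0 <= k < q * L) a (m + k%:Z)%R = q * W m)%N.
  elim: q => [|q IH]; first by rewrite !mul0n big_geq.
  rewrite mulSn addnC (big_cat_nat (n := q * L)) ?leq_addr//=.
  rewrite IH mulSn addnC; congr addn.
  rewrite -{1}(add0n (q * L)%N) big_addn addKn.
  by apply: eq_bigr => k _; rewrite PoszD addrA a_perN.
pose D := W 0; have D_le : (D <= L)%N.
  rewrite /D /W -[leqRHS]muln1 -[X in (X * 1)%N]subn0 -sum_nat_const_nat.
  by apply: leq_sum => k _; exact: leq_b1.
pose c n := (\sum_(0 <= k < n.*2.+1) a (k%:Z - n%:Z)%R)%N.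
have cE n : exists2 e, (e <= L)%N &
    (c n = (n.*2.+1 %/ L) * D + e)%N.
  exists (\sum_((n.*2.+1 %/ L) * L <= k < n.*2.+1) a (k%:Z - n%:Z)%R)%N.
    apply: (@leq_trans (n.*2.+1 - (n.*2.+1 %/ L) * L)); last first.
      by rewrite {1}(divn_eq n.*2.+1 L) addKn ltnW// ltn_mod.
    rewrite -[leqRHS]muln1 -sum_nat_const_nat.
    by apply: leq_sum => k _; exact: leq_b1.
  rewrite /c (big_cat_nat (n := (n.*2.+1 %/ L) * L)) ?leq_trunc_div//=.
  congr addn; rewrite /D -(W_N n) -block.
  by apply: eq_bigr => k _; rewrite addrC.
have L0R : (0 : R) < L%:R by rewrite ltr0n.
apply/cvg_ex; exists (D%:R / L%:R); apply/cvgrPdist_le => /= eps eps0.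
near=> n.
rewrite /density_seq card_window -/(c n) distrC.
have [e eL ->] := cE n; set M := n.*2.+1; set q := (M %/ L)%N.
have M0 : (0 : R) < M%:R by rewrite ltr0n.
have ME : M%:R = q%:R * L%:R + (M %% L)%N%:R :> R.
  by rewrite -natrM -natrD -divn_eq.
have -> : (q * D + e)%N%:R / M%:R - D%:R / L%:R
    = (e%:R - D%:R * (M %% L)%N%:R / L%:R) / M%:R :> R.
  rewrite natrD natrM; apply: (mulIf (lt0r_neq0 M0)).
  rewrite mulrBl !divfK ?gt_eqF// ME.
  by field; rewrite gt_eqF.
rewrite normrM normfV (gtr0_norm M0) ler_pdivrMr//.
have x0 : (0 : R) <= D%:R * (M %% L)%N%:R / L%:R by rewrite !mulr_ge0 ?invr_ge0 ?ler0n.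
have xL : D%:R * (M %% L)%N%:R / L%:R <= L%:R :> R.
  rewrite ler_pdivrMr// -!natrM ler_nat leq_mul//.
  by rewrite ltnW// ltn_mod.
have e0 : (0 : R) <= e%:R by [].
have {}eL : (e%:R : R) <= L%:R by rewrite ler_nat.
apply: (@le_trans _ _ L%:R).
  by rewrite ler_norml; apply/andP; split; lra.
have : L%:R / eps <= n%:R by near: n; exact: nbhs_infty_ger.
rewrite ler_pdivrMr// mulrC => /le_trans; apply.
by rewrite ler_pM2l// ler_nat /M -addnn ltnW// ltnS leq_addr.
Unshelve. all: by end_near.
Qed.

Lemma cvg_density_uncovered (R : realType) (C : {fset nat * nat}) :
  residue_system C -> cvgn (@density_seq R (uncovered C)).
Proof.
move=> C_pos.
have L0 : (0 < \prod_(p <- C) p.1)%N.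
  by rewrite big_seq prodn_cond_gt0// => p /C_pos[].
apply: (@cvg_density_periodic R _ _ L0) => m.
have E p : p \in C -> (m + (\prod_(p <- C) p.1)%N%:Z = m %[mod p.1%:Z])%Z.
  move=> pC; rewrite (big_fsetD1 p)//= PoszM mulrC.
  by rewrite addrC modzMDl.
by split => H p pC; have := H p pC; rewrite E.
Qed.

(* Main.v *)
Require Import Defs.
From mathcomp Require Import all_boot all_order all_algebra.
From mathcomp Require Import finmap multiset.
From mathcomp Require Import reals sequences exp.
From mathcomp Require Import ring lra zify.
From mathcomp Require Import boolp classical_sets cardinality set_interval.
From mathcomp Require Import topology normedtype.

Import Order.TTheory GRing.Theory Num.Theory.
Local Open Scope ring_scope.

(** Since the uncovered set is periodic, it suffices to find one uncovered
    integer.  We use the distortion method of Balister, Bollobas, Morris,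
    Sahasrabudhe and Tiba.  Put X = sqrt (log N loglog N) and Q = e^X.

    The classes whose modulus has all its prime factors at most Q have total
    density at most s times the sum of 1/n over the Q-smooth n > N.  Rankin's
    trick, with n^eta / N^eta for eta = kappa loglog N / X and b < kappa < 1/2,
    makes this at most e^(bX - kappa X + o(X)).

    The remaining primes p > Q are treated in increasing order, with a
    probability weight w on the integers modulo the p-smooth part of the
    moduli.  On each fibre over the previous modulus, if the classes of largest
    prime p cover a proportion alpha < 1/2, the weight is moved off them;
    otherwise it is left alone.  The weight is at most doubled, so that a class
    mod m has weight at most 2^omega(m) / m, and the mass newly lost is at most
    E[2 alpha^2], which is O(s^2 (log p)^O(1) / p^2).  Summed over p > Q this is
    e^((2b - 1) X + o(X)).  As b < 1/2 both losses are small, and a point of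
    positive weight stays uncovered. *)

(** * Means of periodic functions *)

Section Mean.
Variable R : realType.
Implicit Types (f g : nat -> R) (A P M : nat).

Definition periodic A f := forall x, f (x + A)%N = f x.

Definition mean M f : R := (\sum_(0 <= x < M) f x) / M%:R.

(** The conditional expectation of [f] given the residue modulo [A], when [f] has period [A * P]. *)
Definition fibre A P f (x : nat) : R := mean P (fun t => f (x + A * t)%N).

Lemma periodicM A f k x : periodic A f -> f (x + A * k)%N = f x.
Proof.
move=> pf; elim: k => [|k IH]; first by rewrite muln0 addn0.
by rewrite mulnS addnCA addnC pf.
Qed.

Lemma periodic_dvd A M f : periodic A f -> (A %| M)%N -> periodic M f.
Proof. by move=> pf /dvdnP[k ->] x; rewrite mulnC periodicM. Qed.

Lemma periodic_mod A f x : periodic A f -> f (x %% A)%N = f x.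
Proof. by move=> pf; rewrite {2}(divn_eq x A) addnC mulnC periodicM. Qed.

Lemma periodic_mul A f g :
  periodic A f -> periodic A g -> periodic A (fun x => f x * g x).
Proof. by move=> pf pg x; rewrite pf pg. Qed.

Lemma periodic_eqmod m r : periodic m (fun x => (x == r %[mod m])%:R).
Proof. by move=> x; rewrite modnDr. Qed.

Lemma eq_mean M f g : f =1 g -> mean M f = mean M g.
Proof. by move=> fg; congr (_ / _); apply: eq_bigr. Qed.

Lemma le_mean M f g : (forall x, f x <= g x) -> mean M f <= mean M g.
Proof. by move=> fg; rewrite ler_wpM2r ?invr_ge0// ler_sum. Qed.

Lemma mean_ge0 M f : (forall x, 0 <= f x) -> 0 <= mean M f.
Proof. by move=> f0; rewrite mulr_ge0 ?invr_ge0// sumr_ge0. Qed.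

Lemma meanD M f g : mean M (fun x => f x + g x) = mean M f + mean M g.
Proof. by rewrite /mean big_split mulrDl. Qed.

Lemma meanZ M (a : R) f : mean M (fun x => a * f x) = a * mean M f.
Proof. by rewrite /mean -big_distrr/= mulrA. Qed.

Lemma mean_sum M (I : Type) (s : seq I) (F : I -> nat -> R) :
  mean M (fun x => \sum_(i <- s) F i x) = \sum_(i <- s) mean M (F i).
Proof. by rewrite /mean exchange_big/= -big_distrl. Qed.

Lemma mean_cst M (a : R) : (0 < M)%N -> mean M (fun=> a) = a.
Proof.
move=> M0; rewrite /mean sumr_const_nat subn0 -[a *+ M]mulr_natr.
by rewrite mulfK// pnatr_eq0 -lt0n.
Qed.

Lemma sum_blocks A P f :
  \sum_(0 <= x < A * P) f x =
  \sum_(0 <= x < A) \sum_(0 <= t < P) f (x + A * t)%N.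
Proof.
elim: P => [|P IH]; first by rewrite muln0 big_geq// big1// => *; rewrite big_geq.
rewrite mulnS addnC (big_cat_nat (n := (A * P)%N)) ?leq_addr//= IH.
rewrite -{1}(add0n (A * P)%N) big_addn addKn -big_split/=.
by apply: eq_bigr => x _; rewrite big_nat_recr.
Qed.

(** The tower property: [f] is constant on each fibre [x + A * t], so it comes out of the inner
    mean. *)
Lemma mean_fibre A P f g : periodic A f ->
  mean (A * P) (fun x => f x * g x) = mean A (fun x => f x * fibre A P g x).
Proof.
move=> pf; rewrite /mean sum_blocks natrM invfM [A%:R^-1 * _]mulrC mulrA.
congr (_ * _); rewrite mulr_suml; apply: eq_bigr => x _.
rewrite /fibre /mean mulrA; congr (_ * _); rewrite big_distrr/=.
by apply: eq_bigr => t _; rewrite periodicM.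
Qed.

(** Since [A] is invertible modulo [P], sending t to x + A t permutes the residues modulo [P]. *)
Lemma fibre_coprime A P g x : (0 < P)%N -> coprime A P -> periodic P g ->
  fibre A P g x = mean P g.
Proof.
move=> P0 cAP pg; congr (_ / _).
rewrite !big_mkord.
pose h (i : 'I_P) : 'I_P := Ordinal (ltn_pmod (x + A * i) P0).
have hi : injective h.
  move=> i j /(congr1 val)/= /eqP; rewrite eqn_modDl.
  wlog ij : i j / (j <= i)%N => [W E|].
    have [ji|/ltnW ij] := leqP j i; first exact: W.
    by apply/esym/W; rewrite // eq_sym.
  rewrite eqn_mod_dvd ?leq_mul2l ?ij ?orbT// -mulnBr Gauss_dvdr; last first.
    by rewrite coprime_sym.
  move=> d; apply/val_inj/eqP; rewrite eqn_leq ij andbT -subn_eq0.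
  move: d; apply: contraLR => d; rewrite gtnNdvd ?lt0n//.
  exact: leq_ltn_trans (leq_subr _ _) (ltn_ord i).
rewrite [RHS](reindex_inj hi); apply: eq_bigr => i _ /=.
by rewrite periodic_mod.
Qed.

Lemma fibre_periodicM A P f g x : periodic A f ->
  fibre A P (fun y => f y * g y) x = f x * fibre A P g x.
Proof.
move=> pf; rewrite /fibre -meanZ; apply: eq_mean => t.
by rewrite periodicM.
Qed.

Lemma fibre_periodic A P f : periodic (A * P) f -> periodic A (fibre A P f).
Proof.
move=> pf x; rewrite /fibre /mean; congr (_ / _).
case: P pf => [|P] pf; first by rewrite !big_geq.
rewrite big_nat_recr//= [RHS]big_nat_recl//= addrC; congr (_ + _).
  by rewrite muln0 addn0 -addnA -mulnS pf.
by apply: eq_bigr => t _; rewrite mulnS addnA.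
Qed.

Lemma mean_eqmod m r M : (0 < m)%N -> (0 < M)%N -> (m %| M)%N ->
  mean M (fun x => (x == r %[mod m])%:R) = m%:R^-1.
Proof.
move=> m0 M0 /dvdnP[k Mk]; have k0 : (0 < k)%N by move: M0; rewrite Mk muln_gt0 => /andP[].
pose f := fun x => (x == r %[mod m])%:R : R.
have pf : periodic m f by exact: periodic_eqmod.
transitivity (mean m f).
  rewrite Mk mulnC -(eq_mean (m * k) (fun x => f x * 1)).
    by rewrite mean_fibre//; apply: eq_mean => x; rewrite /fibre mean_cst ?mulr1.
  by move=> x; rewrite mulr1.
rewrite /mean big_mkord (bigD1 (Ordinal (ltn_pmod r m0)))//= big1 => [|i].
  by rewrite /f modn_mod eqxx addr0 div1r.
move=> /negP ir; rewrite /f modn_small//; case: eqP => // irE; case: ir.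
by apply/eqP/val_inj.
Qed.
End Mean.

(** * Sums over divisors *)

(** Unique factorisation; it lets sums over divisors be built up one prime at a time. *)
Lemma perm_divisors_mul_pfactor (A p e : nat) :
  (0 < A)%N -> prime p -> coprime A p ->
  perm_eq (divisors (A * p ^ e))
    [seq (m * p ^ j)%N | m <- divisors A, j <- iota 0 e.+1].
Proof.
move=> A0 pp cAp; have p0 := prime_gt0 pp.
have pe0 j : (0 < p ^ j)%N by rewrite expn_gt0 p0.
have cop m j : (m %| A)%N -> coprime m (p ^ j).
  by move=> mA; apply/coprimeXr; apply: coprime_dvdl cAp.
apply: uniq_perm; first exact: divisors_uniq.
  apply: allpairs_uniq; [exact: divisors_uniq|exact: iota_uniq|].
  move=> x y /allpairsP[[m1 j1] [m1A _ ->]] /allpairsP[[m2 j2] [m2A _ ->]] /=.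
  move: m1A m2A => /=; rewrite -!dvdn_divisors// => m1A m2A /= E.
  have L m j : (m %| A)%N -> logn p (m * p ^ j) = j.
    move=> mA; rewrite lognM ?(dvdn_gt0 A0 mA)// pfactorK// logn_coprime//.
    by rewrite coprime_sym; have := cop m 1%N mA; rewrite expn1.
  have jE : j1 = j2 by rewrite -(L m1 j1)// -(L m2 j2)// E.
  by move: E; rewrite jE => /eqP; rewrite eqn_pmul2r// => /eqP ->.
move=> d; rewrite -dvdn_divisors ?muln_gt0 ?A0 ?pe0//.
apply/idP/allpairsP => [dA|[[m j] [+ + ->]]]; last first.
  by rewrite -dvdn_divisors// mem_iota add0n ltnS/= => mA je; rewrite dvdn_mul// dvdn_exp2l.
have d0 : (0 < d)%N by apply: dvdn_gt0 dA; rewrite muln_gt0 A0 pe0.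
have [m pm dE] := pfactor_coprime pp d0.
exists (m, logn p d); split=> //.
  rewrite /= -dvdn_divisors// -(Gauss_dvdl _ (p := p ^ e)).
    by apply: dvdn_trans dA; rewrite {1}dE dvdn_mulr.
  by rewrite coprimeXr// coprime_sym.
rewrite mem_iota/= add0n ltnS -(dvdn_Pexp2l _ _ (prime_gt1 pp)).
rewrite -(@Gauss_dvdr (p ^ logn p d) A); last by rewrite coprime_sym coprimeXr.
by apply: dvdn_trans dA; rewrite {2}dE dvdn_mull.
Qed.

Lemma lcmn_mul_pfactor (p m1 m2 a b : nat) :
  coprime p m1 -> coprime p m2 ->
  lcmn (m1 * p ^ a) (m2 * p ^ b) = (lcmn m1 m2 * p ^ maxn a b)%N.
Proof.
move=> c1 c2.
have cX m j : coprime p m -> coprime m (p ^ j).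
  by move=> c; rewrite coprimeXr// coprime_sym.
have cl : coprime p (lcmn m1 m2).
  have : coprime p (m1 * m2) by rewrite coprimeMr c1 c2.
  by apply: coprime_dvdr; rewrite dvdn_lcm dvdn_mulr// dvdn_mull.
have E d : (lcmn (m1 * p ^ a) (m2 * p ^ b) %| d)%N =
           (lcmn m1 m2 * p ^ maxn a b %| d)%N.
  rewrite dvdn_lcm !Gauss_dvd ?cX// dvdn_lcm.
  have -> : (p ^ maxn a b %| d)%N = (p ^ a %| d)%N && (p ^ b %| d)%N.
    wlog ab : a b / (a <= b)%N => [W|].
      case/orP: (leq_total a b); first exact: W.
      by rewrite maxnC andbC; exact: W.
    rewrite (maxn_idPr ab); case pb : (p ^ b %| d)%N; rewrite ?andbF ?andbT//.
    by rewrite (dvdn_trans _ pb)// dvdn_exp2l.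
  by rewrite andbACA.
by apply/eqP; rewrite eqn_dvd E dvdnn -E dvdnn.
Qed.

(** All primes carry the same exponent [e]: passing to the next prime multiplies by a coprime prime
    power, and once [e] is at least every modulus, [smooth_modulus e e] is a common multiple of
    them. *)
Definition smooth_modulus (e y : nat) : nat := (\prod_(1 <= p < y.+1 | prime p) p ^ e)%N.

Lemma smooth_modulus0 e : smooth_modulus e 0 = 1%N.
Proof. by rewrite /smooth_modulus big_geq. Qed.

Lemma smooth_modulusS e y : smooth_modulus e y.+1 =
  (if prime y.+1 then smooth_modulus e y * y.+1 ^ e else smooth_modulus e y)%N.
Proof.
rewrite /smooth_modulus big_mkcond big_nat_recr//= -big_mkcond/=.
by case: ifP => // _; rewrite muln1.
Qed.

Lemma smooth_modulus_gt0 e y : (0 < smooth_modulus e y)%N.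
Proof. by apply: prodn_cond_gt0 => p /prime_gt0 p0; rewrite expn_gt0 p0. Qed.

Lemma coprime_smooth_modulus e y p :
  prime p -> (y < p)%N -> coprime (smooth_modulus e y) p.
Proof.
move=> pp; elim: y => [|y IH] yp; first by rewrite smooth_modulus0 coprime1n.
rewrite smooth_modulusS; case: ifP => [py|_]; last by rewrite IH// ltnW.
rewrite coprimeMl IH ?(ltnW yp)//= coprimeXl// prime_coprime//.
by rewrite dvdn_prime2// neq_ltn yp.
Qed.

(** The prime factors of [n] are at most [e], and their exponents are less than [n]. *)
Lemma dvdn_smooth_modulus e n : (0 < n <= e)%N -> (n %| smooth_modulus e e)%N.
Proof.
move=> /andP[n0 ne]; rewrite -{1}(partnT n0) (widen_partn _ ne) big_ltn//.
rewrite lognE expn0 mul1n /smooth_modulus [X in (_ %| X)%N]big_mkcond/=.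
apply: (big_ind2 dvdn) => // [|p _]; first by move=> *; rewrite dvdn_mul.
have [pp|np] := boolP (prime p); last by rewrite lognE (negbTE np).
by rewrite dvdn_exp2l// ltnW// (leq_trans _ ne)// ltn_logl.
Qed.

Section DivisorSums.
Variable R : realType.

Lemma divisor_sum_mul_pfactor (A p e : nat) (F : nat -> R) :
  (0 < A)%N -> prime p -> coprime A p ->
  \sum_(d <- divisors (A * p ^ e)) F d =
  \sum_(m <- divisors A) \sum_(0 <= j < e.+1) F (m * p ^ j)%N.
Proof.
move=> A0 pp cAp; rewrite (perm_big _ (perm_divisors_mul_pfactor A p e A0 pp cAp)).
by rewrite big_flatten big_map; apply: eq_bigr => m _; rewrite big_map.
Qed.

Definition weight (m : nat) : R := 2 ^+ size (primes m) / m%:R.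

(** Arises from expanding the square of a sum over classes, since two classes meet in a class modulo
    the lcm or not at all. *)
Definition lcm_weight (A : nat) : R :=
  \sum_(m <- divisors A) \sum_(n <- divisors A) weight (lcmn m n).

Lemma weight_ge0 m : 0 <= weight m.
Proof. by rewrite divr_ge0// exprn_ge0. Qed.

Lemma invr_le_weight m : m%:R^-1 <= weight m.
Proof. by rewrite /weight -[leLHS]mul1r ler_wpM2r ?invr_ge0// exprn_ege1// ler1n. Qed.

Lemma weight_mul_pfactor m p j : (0 < m)%N -> prime p -> coprime m p -> (0 < j)%N ->
  weight (m * p ^ j) = weight m * (2 / p%:R ^+ j).
Proof.
move=> m0 pp cmp j0; have p0 := prime_gt0 pp.
have E : perm_eq (primes (m * p ^ j)) (p :: primes m).
  apply: uniq_perm; first exact: primes_uniq.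
    rewrite /= primes_uniq andbT mem_primes pp m0/=.
    by rewrite -prime_coprime// coprime_sym.
  move=> q; rewrite primesM ?expn_gt0 ?p0// primesX// (primes_prime pp).
  by rewrite !inE orbC.
rewrite /weight (perm_size E)/= exprS natrM natrX invfM.
by rewrite !mulrA [2 * _]mulrC -!mulrA; congr (_ * _); rewrite mulrCA.
Qed.

Let local_weight p j : R := if j == 0%N then 1 else 2 / p%:R ^+ j.

(** Exactly 2k + 1 pairs have maximum k. For p = 2 the infinite sum equals 1 + 20 / 2, which fixes
    the constant 20. *)
Lemma local_weight_sum (p e : nat) : (1 < p)%N ->
  \sum_(0 <= i < e.+1) \sum_(0 <= j < e.+1) local_weight p (maxn i j) <=
  1 + 20 / p%:R.
Proof.
move=> p1; have pR : (2 : R) <= p%:R by rewrite ler_nat.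
have p0 : (0 : R) < p%:R by lra.
(* The subtracted term is chosen so that the bound survives the step from [e]
   to [e + 1] for every [p >= 2]. *)
suff : \sum_(0 <= i < e.+1) \sum_(0 <= j < e.+1) local_weight p (maxn i j) <=
    1 + 20 / p%:R - (8 * e%:R + 20) / p%:R ^+ e.+1.
  move=> /le_trans; apply; rewrite lerBlDr lerDl divr_ge0 ?exprn_ge0 ?(ltW p0)//.
  by rewrite addr_ge0// mulr_ge0.
elim: e => [|e IH].
  rewrite !big_nat1 maxnn /local_weight eqxx expr1; lra.
have -> : \sum_(0 <= i < e.+2) \sum_(0 <= j < e.+2) local_weight p (maxn i j) =
  \sum_(0 <= i < e.+1) \sum_(0 <= j < e.+1) local_weight p (maxn i j) +
  (e.*2.+3)%:R * (2 / p%:R ^+ e.+1).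
  rewrite big_nat_recr//=.
  under eq_bigr do rewrite big_nat_recr//=.
  rewrite big_split/= -addrA; congr (_ + _).
  have E i : (i <= e.+1)%N -> local_weight p (maxn i e.+1) = 2 / p%:R ^+ e.+1.
    by move=> ie; rewrite (maxn_idPr ie).
  rewrite (eq_big_nat _ _ (F2 := fun=> 2 / p%:R ^+ e.+1)); last first.
    by move=> i /andP[_ ie]; rewrite E// ltnW.
  rewrite [X in _ + X](eq_big_nat _ _ (F2 := fun=> 2 / p%:R ^+ e.+1)); last first.
    by move=> i /andP[_ ie]; rewrite maxnC E.
  rewrite !sumr_const_nat -mulrnDr [RHS]mulr_natl; congr (_ *+ _).
  by rewrite !subn0 -addnn; lia.
have pe : (0 : R) < p%:R ^+ e.+2 by rewrite exprn_gt0.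
apply: (le_trans (lerD IH (lexx _))).
rewrite -!addrA !lerD2l.
have -> : (8 * e%:R + 20) / p%:R ^+ e.+1 = (8 * e%:R + 20) * p%:R / p%:R ^+ e.+2 :> R.
  by rewrite [p%:R ^+ e.+2]exprSr; field; rewrite !lt0r_neq0 ?exprn_gt0.
have -> : 2 / p%:R ^+ e.+1 = 2 * p%:R / p%:R ^+ e.+2 :> R.
  by rewrite [p%:R ^+ e.+2]exprSr; field; rewrite !lt0r_neq0 ?exprn_gt0.
rewrite mulrA -!mulNr -mulrDl ler_pM2r ?invr_gt0//.
have e0 : (0 : R) <= e%:R by [].
have -> : (e.*2.+3)%:R = 2 * e%:R + 3 :> R by rewrite -addn3 natrD -muln2 natrM mulrC.
have -> : e.+1%:R = e%:R + 1 :> R by rewrite -natr1.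
nra.
Qed.

(** Exponents of [p] combine by maximum in the lcm, and [weight] is multiplicative over coprime
    parts, so the double sum splits off a local factor at [p]. *)
Lemma lcm_weight_mul_pfactor A p e : (0 < A)%N -> prime p -> coprime A p ->
  lcm_weight (A * p ^ e) <= lcm_weight A * (1 + 20 / p%:R).
Proof.
move=> A0 pp cAp; rewrite /lcm_weight divisor_sum_mul_pfactor//.
have cop m : m \in divisors A -> coprime p m.
  rewrite -dvdn_divisors// => mA; rewrite coprime_sym.
  exact: coprime_dvdl cAp.
have E m1 m2 i j : m1 \in divisors A -> m2 \in divisors A ->
  weight (lcmn (m1 * p ^ i) (m2 * p ^ j)) =
  weight (lcmn m1 m2) * local_weight p (maxn i j).
  move=> m1A m2A; rewrite lcmn_mul_pfactor ?cop// /local_weight.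
  case: posnP => [->|ij]; first by rewrite expn0 muln1 mulr1.
  have lA : (lcmn m1 m2 %| A)%N by rewrite dvdn_lcm !dvdn_divisors// m1A.
  by rewrite weight_mul_pfactor// ?(dvdn_gt0 A0 lA)// (coprime_dvdl lA).
rewrite big_seq mulr_suml big_seq; apply: ler_sum => m1 m1A.
under eq_bigr do rewrite divisor_sum_mul_pfactor//.
rewrite exchange_big/= big_seq mulr_suml big_seq; apply: ler_sum => m2 m2A.
under eq_bigr do under eq_bigr do rewrite E//.
under eq_bigr do rewrite -big_distrr/=.
rewrite -big_distrr/= ler_wpM2l ?weight_ge0// local_weight_sum//.
exact: prime_gt1.
Qed.

Definition prime_recip (y : nat) : R := \sum_(1 <= p < y.+1 | prime p) p%:R^-1.

Lemma prime_recip0 : prime_recip 0 = 0.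
Proof. by rewrite /prime_recip big_geq. Qed.

Lemma prime_recipS y : prime_recip y.+1 =
  prime_recip y + (if prime y.+1 then y.+1%:R^-1 else 0).
Proof. by rewrite /prime_recip big_mkcond big_nat_recr//= -big_mkcond. Qed.

Lemma lcm_weight_smooth_modulus e y :
  lcm_weight (smooth_modulus e y) <= expR (20 * prime_recip y).
Proof.
elim: y => [|y IH].
  rewrite smooth_modulus0 prime_recip0 mulr0 expR0 /lcm_weight.
  rewrite (_ : divisors 1 = [:: 1%N])// !big_seq1.
  by rewrite /weight expr0 divr1.
rewrite smooth_modulusS prime_recipS; case: ifP => [yp|_]; last by rewrite addr0.
apply: (le_trans (lcm_weight_mul_pfactor _ _ _ _ _ _)) => //.
- exact: smooth_modulus_gt0.
- exact: coprime_smooth_modulus.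
rewrite [X in expR X]mulrDr expRD ler_pM//.
- by do 2!apply: sumr_ge0 => ? _; exact: weight_ge0.
- by rewrite addr_ge0// divr_ge0.
- exact: expR_ge1Dx.
Qed.

(** The sum is at most 1 / (1 - z), and (1 + 4z)(1 - z) >= 1 exactly when 0 <= z <= 3/4. *)
Lemma geometric_sum_le (z : R) n : 0 <= z -> z <= 3 / 4 ->
  \sum_(0 <= j < n) z ^+ j <= expR (4 * z).
Proof.
move=> z0 z1; apply: le_trans (expR_ge1Dx _).
have E : (\sum_(0 <= j < n) z ^+ j) * (1 - z) = 1 - z ^+ n.
  elim: n => [|n IH]; first by rewrite big_geq// mul0r subrr.
  by rewrite big_nat_recr//= mulrDl IH exprSr; ring.
have zn : 0 <= z ^+ n by rewrite exprn_ge0.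
rewrite -(ler_pM2r (_ : 0 < 1 - z)) ?E; nra.
Qed.

(** An Euler product: the factor at p is a geometric sum in p^(-theta) = p^(1 - theta) / p, which is
    at most T / p. *)
Lemma smooth_powR_sum (e y : nat) (theta T : R) : 1 / 2 <= theta ->
  (forall p, prime p -> (p <= y)%N -> p%:R `^ (1 - theta) <= T) ->
  \sum_(d <- divisors (smooth_modulus e y)) d%:R `^ (- theta) <=
  expR (4 * T * prime_recip y).
Proof.
move=> th; elim: y => [|y IH] HT.
  rewrite smooth_modulus0 prime_recip0 mulr0 expR0.
  by rewrite (_ : divisors 1 = [:: 1%N])// big_seq1 powR1.
rewrite smooth_modulusS prime_recipS; case: ifP => [yp|_]; last first.
  by rewrite addr0 IH// => p pp py; rewrite HT// ltnW.
rewrite divisor_sum_mul_pfactor// ?smooth_modulus_gt0 ?coprime_smooth_modulus//.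
set z : R := y.+1%:R `^ (- theta).
have y1 : (2 : R) <= y.+1%:R by rewrite ler_nat prime_gt1.
have z0 : 0 <= z by exact: powR_ge0.
(* As theta >= 1/2 and the prime is at least 2, z is at most 2^(-1/2) < 3/4. *)
have z1 : z <= 3 / 4.
  have w : z <= 2 `^ (- (1 / 2)).
    apply: (@le_trans _ _ (y.+1%:R `^ (- (1 / 2)))).
      by rewrite ler_powR//; lra.
    rewrite !powRN lef_pV2 ?posrE ?powR_gt0//.
    by apply: ge0_ler_powR; rewrite ?nnegrE//; lra.
  have w2 : (2 `^ (- (1 / 2)) : R) ^+ 2 = 1 / 2.
    rewrite -powR_mulrn ?powR_ge0// -powRrM (_ : - (1 / 2) * 2 = -1 :> R); last lra.
    by rewrite powR_inv1// div1r.
  have : (0 : R) <= 2 `^ (- (1 / 2)) by exact: powR_ge0.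
  by nra.
have zT : z <= T / y.+1%:R.
  rewrite ler_pdivlMr; last lra.
  rewrite -[X in _ * X]powRr1// -powRD; last by apply/implyP => _; lra.
  by rewrite addrC HT.
have E m j : (m * y.+1 ^ j)%:R `^ (- theta) = m%:R `^ (- theta) * z ^+ j.
  rewrite natrM powRM// natrX; congr (_ * _).
  rewrite -(powR_mulrn j (ler0n R y.+1)) -(powR_mulrn j z0).
  by rewrite -!powRrM [_ * j%:R]mulrC.
under eq_bigr do under eq_bigr do rewrite E.
under eq_bigr do rewrite -big_distrr/=.
rewrite -big_distrl/= [X in expR X]mulrDr expRD ler_pM//.
- by apply: sumr_ge0 => ? _; exact: powR_ge0.
- by apply: sumr_ge0 => ? _; rewrite exprn_ge0.
- by rewrite IH// => p pp py; rewrite HT// ltnW.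
apply: (le_trans (geometric_sum_le _ _ z0 z1)).
by rewrite ler_expR -mulrA ler_pM2l.
Qed.
End DivisorSums.

(** * Sums of reciprocals of primes *)

Lemma bin_le_exp2 n k : ('C(n, k) <= 2 ^ n)%N.
Proof.
elim: n k => [|n IH] [|k]; rewrite ?bin0 ?expn_gt0// binS.
by rewrite expnS mul2n -addnn leq_add.
Qed.

(** Such a prime divides (2n)! but not n!. *)
Lemma prime_dvd_central_bin p n : prime p -> (n < p <= n.*2)%N -> (p %| 'C(n.*2, n))%N.
Proof.
move=> pp /andP[np p2].
have ndvd k : (k < p)%N -> ~~ (p %| k`!)%N.
  elim: k => [|k IH] kp; first by rewrite fact0 dvdn1 neq_ltn prime_gt1 ?orbT.
  by rewrite factS Euclid_dvdM// negb_or IH ?(ltnW kp)// gtnNdvd.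
have : (p %| (n.*2)`!)%N by rewrite dvdn_fact// prime_gt0.
rewrite -(@bin_fact _ n); last by rewrite -addnn leq_addr.
have -> : (n.*2 - n = n)%N by rewrite -addnn addnK.
by rewrite !Euclid_dvdM// (negbTE (ndvd _ np)) !orbF.
Qed.

Lemma dvdn_prod_primes (s : seq nat) N : uniq s -> all prime s ->
  all (fun p => p %| N)%N s -> (\prod_(p <- s) p %| N)%N.
Proof.
elim: s => [|p s IH] /=; first by rewrite big_nil dvd1n.
move=> /andP[ps us] /andP[pp sp] /andP[pN sN]; rewrite big_cons Gauss_dvd ?pN ?IH//.
rewrite prime_coprime//; apply/negP.
elim: s ps sp {IH us sN} => [|q s IH]; first by rewrite big_nil dvdn1 => _ _ /eqP p1; rewrite p1 in pp.
rewrite inE negb_or big_cons Euclid_dvdM//= => /andP[pq ps] /andP[qp sp].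
by rewrite dvdn_prime2// (negbTE pq)/=; exact: IH.
Qed.

Section PrimeReciprocals.
Variable R : realType.

(* The primes in (n, 2n] all divide the central binomial coefficient, which is
   at most 4^n; here n = 2^k. *)
Lemma dyadic_prime_recip k : (0 < k)%N ->
  \sum_(2 ^ k + 1 <= p < 2 ^ k.+1 + 1 | prime p) p%:R^-1 <= 2 / k%:R :> R.
Proof.
move=> k0; set n := (2 ^ k)%N.
have n0 : (0 < n)%N by rewrite expn_gt0.
have n2 : (2 ^ k.+1 = n.*2)%N by rewrite expnS mul2n.
pose s := [seq p <- index_iota (n + 1) (n.*2 + 1) | prime p].
have sP p : p \in s -> prime p /\ (n < p <= n.*2)%N.
  by rewrite mem_filter mem_index_iota addn1 addn1 ltnS => /andP[].
have n_s : (n ^ size s <= 2 ^ n.*2)%N.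
  apply: (@leq_trans (\prod_(p <- s) p)).
    have : all (leq n) s by apply/allP => p /sP[_ /andP[/ltnW]].
    elim: (s) => [|p t IH] /=; first by rewrite big_nil.
    by move=> /andP[np nt]; rewrite big_cons expnS leq_mul// IH.
  apply: leq_trans (bin_le_exp2 _ n); apply: dvdn_leq.
    by rewrite bin_gt0 -addnn leq_addr.
  apply: dvdn_prod_primes; first by rewrite filter_uniq// iota_uniq.
    by apply/allP => p /sP[].
  by apply/allP => p /sP[pp pn]; exact: prime_dvd_central_bin.
have ks : (k * size s <= n.*2)%N.
  by rewrite -(leq_exp2l (m := 2))// expnM.
rewrite n2 -big_filter -/s.
apply: (@le_trans _ _ (\sum_(p <- s) n%:R^-1)).
  rewrite big_seq [leRHS]big_seq; apply: ler_sum => p /sP[_ /andP[np _]].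
  by rewrite lef_pV2 ?posrE ?ltr0n// ?ler_nat ?(ltnW np)// (leq_ltn_trans _ np).
rewrite big_const_seq count_predT iter_addr addr0 -[_ *+ _]mulr_natl.
have nR : (0 : R) < n%:R by rewrite ltr0n.
have kR : (0 : R) < k%:R by rewrite ltr0n.
rewrite ler_pdivrMr// mulrAC ler_pdivlMr//.
by rewrite -!natrM ler_nat mulnC mul2n.
Qed.

Lemma half_le_ln2 : 1 / 2 <= ln 2 :> R.
Proof.
have := @le_ln1Dx R (- (1 / 2)).
rewrite (_ : 1 + - (1 / 2) = 2^-1); last by lra.
by rewrite lnV ?posrE//; lra.
Qed.

Lemma invS_le_lnB k : (0 < k)%N -> (k.+1%:R)^-1 <= ln k.+1%:R - ln k%:R :> R.
Proof.
move=> k0; have kR : (0 : R) < k%:R by rewrite ltr0n.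
have k1 : (k.+1%:R : R) = k%:R + 1 by rewrite -natr1.
have h : (k.+1%:R)^-1 < 1 :> R by rewrite invf_lt1 ?ltr0n// k1; lra.
have : -1 < - (k.+1%:R)^-1 :> R by rewrite ltrN2.
move=> /le_ln1Dx; rewrite (_ : 1 + _ = k%:R / k.+1%:R); last first.
  by rewrite k1; field; lra.
rewrite ln_div ?posrE ?ltr0n//.
by move: (ln _) (ln _) (_^-1) => a b u; lra.
Qed.

(** Sums the dyadic bounds and compares the harmonic sum with the logarithm; 5/2 is 1/2 for the
    prime 2 plus 2 for the block (2, 4]. *)
Lemma prime_recip_exp2 k : (0 < k)%N ->
  prime_recip R (2 ^ k.+1) <= 5 / 2 + 2 * ln k%:R.
Proof.
have S j : (0 < j)%N -> prime_recip R (2 ^ j.+1) <= prime_recip R (2 ^ j) + 2 / j%:R.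
  move=> j0; rewrite /prime_recip (big_cat_nat (n := (2 ^ j).+1))//=; last first.
    by rewrite ltnS leq_pexp2l.
  by rewrite lerD2l; have := dyadic_prime_recip j j0; rewrite !addn1.
elim: k => [//|[_ _|k IH _]].
  apply: (le_trans (S 1%N _)) => //; rewrite ln1 !prime_recipS prime_recip0/=; lra.
apply: (le_trans (S k.+2 _)) => //.
have := IH isT; have := invS_le_lnB k.+1 isT.
by move: (k.+2%:R^-1) (ln k.+2%:R) (ln k.+1%:R) => u a b; lra.
Qed.

Lemma prime_recip_mono y z : (y <= z)%N -> prime_recip R y <= prime_recip R z.
Proof.
move=> /subnK <-; elim: (z - y)%N => [|n IH] //.
rewrite addSn prime_recipS (le_trans IH)// lerDl; case: ifP => // _.
by rewrite invr_ge0.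
Qed.

(** A one-sided Mertens estimate: y <= 2^(k + 2) with k <= 2 ln y, because ln 2 >= 1/2. *)
Lemma prime_recip_le_lnln y : (0 < y)%N ->
  prime_recip R y <= 5 / 2 + 2 * ln (1 + 2 * ln y%:R).
Proof.
move=> y0; set k := trunc_log 2 y.
have y1 : (1 : R) <= y%:R by rewrite ler1n.
have yk : (y <= 2 ^ k.+2)%N.
  by rewrite (leq_trans (ltnW (@trunc_log_ltn 2 y isT)))// leq_exp2l.
have ky : (k%:R : R) <= 2 * ln y%:R.
  have : ln ((2 ^ k)%:R) <= ln y%:R :> R.
    rewrite ler_ln ?posrE ?ltr0n ?expn_gt0// ler_nat.
    exact: trunc_logP.
  rewrite natrX lnXn// -[_ *+ k]mulr_natl => h.
  have := half_le_ln2; have : (0 : R) <= k%:R by [].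
  by nra.
apply: (le_trans (prime_recip_mono _ _ yk)).
apply: (le_trans (prime_recip_exp2 k.+1 isT)).
have l0 := ln_ge0 y1.
have k1 : (k.+1%:R : R) <= 1 + 2 * ln y%:R by rewrite -natr1; lra.
by rewrite lerD2l ler_pM2l// ler_ln ?posrE ?ltr0n//; lra.
Qed.

Lemma prime_recip_le_ln (eps : R) : 0 < eps -> exists K, forall y, (0 < y)%N ->
  prime_recip R y <= K + eps * ln y%:R.
Proof.
(* The constant comes from the tangent bound ln u <= u - 1 at u = (eps / 4)(1 + 2 ln y). *)
move=> e0; exists (5 / 2 + eps / 2 - 2 - 2 * ln (eps / 4)) => y y0.
apply: (le_trans (prime_recip_le_lnln y y0)).
have l0 : (0 : R) <= ln y%:R by rewrite ln_ge0// ler1n.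
set z := 1 + 2 * ln y%:R; have z0 : 0 < z by rewrite /z; lra.
have ez : 0 < eps / 4 * z by rewrite mulr_gt0// divr_gt0.
have : -1 < eps / 4 * z - 1 by lra.
move=> /le_ln1Dx; rewrite (_ : 1 + (_ - 1) = eps / 4 * z); last by lra.
rewrite lnM ?posrE//; last by rewrite divr_gt0.
by rewrite /z; lra.
Qed.
End PrimeReciprocals.

(** * The distortion step *)

Section Distortion.
Variable R : realType.
Variable cs : seq (nat * nat).
Implicit Types (w : nat -> R) (A M : nat) (c : nat * nat).

Definition hit c x := (x == c.2 %[mod c.1])%N.

Definition covered A x := has (fun c => (c.1 %| A)%N && hit c x) cs.

(* [w] is a probability density with respect to the uniform measure modulo [A];
   [eps] bounds the mass lying on the classes whose modulus divides [A]. *)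
Definition distorted A w (eps : R) := [/\ periodic R A w, forall x, 0 <= w x,
  mean R A w = 1,
  forall m r, (m %| A)%N ->
    mean R A (fun x => w x * (x == r %[mod m])%:R) <= weight R m &
  mean R A (fun x => w x * (covered A x)%:R) <= eps].

Lemma covered_periodic A : periodic R A (fun x => (covered A x)%:R).
Proof.
move=> x; congr ((nat_of_bool _)%:R); apply: eq_has => c.
case cA : (c.1 %| A)%N => //=; rewrite /hit.
by rewrite -modnDmr (eqP cA) addn0.
Qed.

Lemma le_has_sum (T : Type) (t : seq T) (P Q : pred T) :
  (has (fun i => P i && Q i) t)%:R <= \sum_(i <- t | P i) (Q i)%:R :> R.
Proof.
elim: t => [|i t IH]; first by rewrite big_nil.
rewrite big_cons /=; case: (P i) => //=.
case: (Q i) => /=; last by rewrite add0r.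
by rewrite lerDl sumr_ge0.
Qed.

(** The starting point of the induction on primes: under the uniform weight the union bound controls
    the covered mass. *)
Lemma distorted_cst A : (0 < A)%N ->
  distorted A (fun=> 1) (\sum_(c <- cs | (c.1 %| A)%N) c.1%:R^-1).
Proof.
move=> A0; split => //.
- exact: mean_cst.
- move=> m r mA; rewrite (eq_mean _ _ _ (fun x => (x == r %[mod m])%:R)) => [|x].
    by rewrite mean_eqmod ?invr_le_weight// (dvdn_gt0 A0).
  by rewrite mul1r.
apply: (@le_trans _ _ (mean R A (fun x => \sum_(c <- cs | (c.1 %| A)%N) (hit c x)%:R))).
  by apply: le_mean => x; rewrite mul1r; exact: le_has_sum.
rewrite (eq_mean _ _ _ (fun x => \sum_(c <- [seq c <- cs | (c.1 %| A)%N]) (hit c x)%:R)); last first.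
  by move=> x; rewrite big_filter.
rewrite mean_sum big_filter; apply: ler_sum => c cA.
by rewrite /hit mean_eqmod// (dvdn_gt0 A0).
Qed.

(** Two classes are disjoint or meet in a single class modulo the lcm of their moduli. *)
Lemma mean_le_distorted_eqmod2 A w eps m1 r1 m2 r2 :
  distorted A w eps -> (m1 %| A)%N -> (m2 %| A)%N ->
  mean R A (fun x => w x * ((x == r1 %[mod m1])%:R * (x == r2 %[mod m2])%:R))
  <= weight R (lcmn m1 m2).
Proof.
move=> [_ w0 _ wAP _] m1A m2A.
have [[x0 /andP[e1 e2]]|no] :=
  pselect (exists x, (x == r1 %[mod m1]) && (x == r2 %[mod m2])); last first.
  rewrite (eq_mean _ _ _ (fun=> 0 * 0)).
    by rewrite meanZ mul0r weight_ge0.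
  move=> x; rewrite -natrM mulnb; case E : (_ && _); last by rewrite mulr0 mul0r.
  by case: no; exists x.
apply: le_trans (wAP _ x0 _); last by rewrite dvdn_lcm m1A.
apply: le_mean => x; rewrite ler_wpM2l// -natrM mulnb ler_nat.
case: andP => // -[/eqP x1 /eqP x2].
rewrite -(eqP e1) in x1; rewrite -(eqP e2) in x2.
suff -> : (x == x0 %[mod lcmn m1 m2]) by [].
move: x1 x2 => /eqP x1 /eqP x2.
case/orP: (leq_total x x0) => xx.
  by rewrite eq_sym eqn_mod_dvd// dvdn_lcm -!eqn_mod_dvd// eq_sym x1 eq_sym.
by rewrite eqn_mod_dvd// dvdn_lcm -!eqn_mod_dvd// x1.
Qed.

Section Step.
Variables (A p e : nat) (w : nat -> R) (eps : R).
Hypotheses (A0 : (0 < A)%N) (pp : prime p) (cAp : coprime A p).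
Hypothesis dw : distorted A w eps.

Let P := (p ^ e)%N.
Let P0 : (0 < P)%N. Proof. by rewrite expn_gt0 prime_gt0. Qed.
Let p0 : (0 : R) < p%:R. Proof. by rewrite ltr0n prime_gt0. Qed.

(** Among the divisors of [A * P], those not dividing [A] are multiples of [p]. *)
Let new c := (c.1 %| A * P)%N && ~~ (c.1 %| A)%N.
Let B x := has (fun c => new c && hit c x) cs.
Let alpha := fibre R A P (fun x => (B x)%:R).
(* The density by which [w] is multiplied: its mean over each fibre is 1. *)
Let g x : R := if alpha x < 1 / 2 then (1 - (B x)%:R) / (1 - alpha x) else 1.
Let w' x := w x * g x.

Let cop m j : (m %| A)%N -> coprime m (p ^ j).
Proof. by move=> mA; apply/coprimeXr; apply: coprime_dvdl cAp. Qed.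

Let dvd_split d : (d %| A * P)%N ->
  exists m j, [/\ (m %| A)%N, (j <= e)%N & d = (m * p ^ j)%N].
Proof.
move=> dA; have AP0 : (0 < A * p ^ e)%N by rewrite muln_gt0 A0.
have : d \in divisors (A * p ^ e) by rewrite -dvdn_divisors.
rewrite (perm_mem (perm_divisors_mul_pfactor _ _ e A0 pp cAp)).
move=> /allpairsP[[m j] [mA je ->]]; exists m, j; split => //.
  by rewrite dvdn_divisors.
by move: je; rewrite mem_iota.
Qed.

Let B_periodic : periodic R (A * P) (fun x => (B x)%:R).
Proof.
move=> x; congr ((nat_of_bool _)%:R); apply: eq_has => c.
case cA : (new c) => //=; rewrite /hit; move: cA => /andP[cA _].
by rewrite -modnDmr (eqP cA) addn0.
Qed.

Let alpha_periodic : periodic R A alpha.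
Proof. exact: fibre_periodic. Qed.

Let alpha_ge0 x : 0 <= alpha x.
Proof. exact: mean_ge0. Qed.

Let g_ge0 x : 0 <= g x.
Proof.
rewrite /g; case: ifPn => // h; rewrite divr_ge0//; last by lra.
by case: (B x); rewrite ?subrr ?subr0.
Qed.

Let g_le2 x : g x <= 2.
Proof.
rewrite /g; case: ifPn => [h|_]; last by lra.
rewrite ler_pdivrMr; last lra.
by have := alpha_ge0 x; case: (B x) => /=; lra.
Qed.

Let g_periodic : periodic R (A * P) g.
Proof.
move=> x; have := B_periodic x; rewrite /g => ->.
by rewrite (periodic_dvd _ _ _ _ alpha_periodic)// dvdn_mulr.
Qed.

Let fibre_alpha (F : R -> R) (h : nat -> R) x :
  fibre R A P (fun y => F (alpha y) * h y) x = F (alpha x) * fibre R A P h x.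
Proof. by apply: fibre_periodicM => y; rewrite alpha_periodic. Qed.

(** As [alpha] is constant on a fibre, one branch of [g] applies throughout it, and 1 - B has mean 1
    - alpha there. *)
Let fibre_g x : fibre R A P g x = 1.
Proof.
(* [F] codes the branch as a function of [alpha], so that it can be taken out of the fibre mean. *)
pose F (a : R) : R := if a < 1 / 2 then 1 else 0.
transitivity (fibre R A P (fun y => F (alpha y) / (1 - alpha y) * (1 + -1 * (B y)%:R)
    + (1 - F (alpha y)) * 1) x).
  apply: eq_mean => t; rewrite /g /F; case: ifP => _; last by lra.
  by lra.
rewrite {1}/fibre meanD.
have := fibre_alpha (fun a => F a / (1 - a)) (fun y => 1 + -1 * (B y)%:R) x.
rewrite /fibre => ->; rewrite meanD meanZ mean_cst//.
rewrite -[X in 1 + -1 * X]/(alpha x).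
have := fibre_alpha (fun a => 1 - F a) (fun=> 1) x.
rewrite /fibre => ->; rewrite mean_cst// /F; case: ifP => h; last by lra.
by rewrite mulN1r mul1r mulVf; lra.
Qed.

(** Below the threshold [g] vanishes on [B]; above it g = 1, and alpha >= 1/2 gives alpha <= 2
    alpha^2. *)
Let fibre_gB x : fibre R A P (fun y => g y * (B y)%:R) x <= 2 * alpha x ^+ 2.
Proof.
pose F (a : R) : R := if a < 1 / 2 then 0 else 1.
rewrite (_ : fibre _ _ _ _ x = F (alpha x) * alpha x).
  rewrite /F; case: ifPn => h; first by rewrite mul0r mulr_ge0// sqr_ge0.
  by rewrite mul1r; nra.
rewrite -fibre_alpha; apply: eq_mean => t; rewrite /g /F; case: ifP => _ //.
by case: (B _); rewrite ?subrr !(mul0r, mulr0).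
Qed.

(* A class modulo [m * p ^ j] meets the fibre over [x] in the proportion
   [p ^- j] if [x] lies in its reduction modulo [m], and not at all otherwise. *)
Let beta x : R :=
  \sum_(c <- [seq c <- cs | new c]) (p%:R ^+ logn p c.1)^-1 *
     (x == c.2 %[mod c.1 %/ p ^ logn p c.1])%:R.

Let logn_part m j : (m %| A)%N -> logn p (m * p ^ j) = j.
Proof.
move=> mA; rewrite lognM ?(dvdn_gt0 A0 mA) ?expn_gt0 ?prime_gt0// pfactorK//.
rewrite logn_coprime// coprime_sym.
by have := cop m 1%N mA; rewrite expn1.
Qed.

Let div_part m j : (m %| A)%N -> (m * p ^ j %/ p ^ logn p (m * p ^ j))%N = m.
Proof. by move=> mA; rewrite logn_part// mulnK// expn_gt0 prime_gt0. Qed.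

(** By the Chinese remainder theorem the condition splits: the part modulo [m] is constant on the
    fibre, and the part modulo [p ^ j] is equidistributed because [A] is prime to [p]. *)
Let fibre_eqmod m j r x : (m %| A)%N -> (j <= e)%N ->
  fibre R A P (fun y => (y == r %[mod m * p ^ j])%:R) x =
  (p%:R ^+ j)^-1 * (x == r %[mod m])%:R.
Proof.
move=> mA je.
rewrite (_ : fibre _ _ _ _ _ = fibre R A P (fun y => (y == r %[mod m])%:R *
   (y == r %[mod p ^ j])%:R) x); last first.
  by apply: eq_mean => t; rewrite chinese_remainder ?cop// -mulnb natrM.
rewrite fibre_periodicM; last exact: periodic_dvd (periodic_eqmod _ _ _) mA.
have jP : (p ^ j %| P)%N by rewrite dvdn_exp2l.
rewrite fibre_coprime//; last 2 first.
- by rewrite coprimeXr.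
- exact: periodic_dvd (periodic_eqmod _ _ _) jP.
by rewrite mean_eqmod// ?expn_gt0 ?prime_gt0// natrX mulrC.
Qed.

Let alpha_le x : alpha x <= beta x.
Proof.
apply: (@le_trans _ _ (fibre R A P (fun y => \sum_(c <- [seq c <- cs | new c]) (hit c y)%:R) x)).
  by apply: le_mean => t; rewrite big_filter; exact: le_has_sum.
rewrite /fibre mean_sum /beta !big_filter; apply: ler_sum => c /andP[cA _].
have [m [j [mA je cE]]] := dvd_split _ cA.
have := fibre_eqmod m j c.2 x mA je; rewrite /fibre /hit cE => ->.
by rewrite div_part// logn_part.
Qed.

Let w'_ge0 x : 0 <= w' x.
Proof. by case: dw => _ w0 _ _ _; rewrite mulr_ge0. Qed.

(** The new weight is [w * g]. Since [g] has mean 1 on fibres, functions of period [A] keep their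
    integral, so the old covered mass does not grow. The added term is twice the mean of
    [w * beta ^ 2], with [beta] written out. *)
Lemma distortion_step : exists w2, distorted (A * p ^ e) w2
  (eps + 2 * mean R A (fun x => w x * (\sum_(c <- [seq c <- cs |
    (c.1 %| A * p ^ e)%N && ~~ (c.1 %| A)%N]) (p%:R ^+ logn p c.1)^-1 *
     (x == c.2 %[mod c.1 %/ p ^ logn p c.1])%:R) ^+ 2)).
Proof.
have [pw w0 w1 wAP wc] := dw.
have sub F : periodic R A F ->
  mean R (A * P) (fun x => w' x * F x) = mean R A (fun x => w x * F x).
  move=> pF.
  rewrite (eq_mean _ _ _ (fun x => (w x * F x) * g x)); last by move=> x; rewrite mulrAC.
  rewrite mean_fibre; last exact: periodic_mul.
  by apply: eq_mean => x; rewrite fibre_g mulr1.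
exists w'; split.
- by move=> x; rewrite /w' g_periodic (periodic_dvd _ _ _ _ pw)// dvdn_mulr.
- exact: w'_ge0.
- transitivity (mean R (A * P) (fun x => w' x * 1)).
    by apply: eq_mean => x; rewrite mulr1.
  by rewrite sub// -[RHS]w1; apply: eq_mean => x; rewrite mulr1.
- move=> d r /dvd_split[m [j [mA je ->]]].
  (* For j = 0 the mass of the class is unchanged. Otherwise g <= 2 costs a factor 2, which the new
     prime [p] contributes to [weight]. *)
  have [->|j0] := posnP j.
    rewrite expn0 muln1; have := sub (fun x => (x == r %[mod m])%:R).
    move=> ->; first exact: wAP.
    exact: periodic_dvd (periodic_eqmod _ _ _) mA.
  have cmp : coprime m p by have := cop m 1%N mA; rewrite expn1.
  rewrite weight_mul_pfactor// ?(dvdn_gt0 A0)//.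
  apply: (@le_trans _ _ (mean R (A * P) (fun x => 2 * w x *
      (x == r %[mod m * p ^ j])%:R))).
    by apply: le_mean => x; rewrite ler_wpM2r// [2 * _]mulrC ler_wpM2l.
  rewrite mean_fibre; last by move=> x; rewrite pw.
  rewrite (eq_mean _ _ _ (fun x => 2 / p%:R ^+ j * (w x * (x == r %[mod m])%:R))).
    rewrite meanZ mulrC ler_wpM2r ?wAP// divr_ge0// exprn_ge0//; exact: ltW.
  by move=> x; rewrite fibre_eqmod//; lra.
apply: (@le_trans _ _ (mean R (A * P) (fun x => w' x * (covered A x)%:R +
    w' x * (B x)%:R))).
  apply: le_mean => x; rewrite -mulrDr ler_wpM2l// -natrD ler_nat.
  rewrite /covered /B.
  case: hasP => // -[c cC /andP[cA hc]].
  have [c1|c1] := boolP (c.1 %| A)%N.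
    by rewrite ltn_addr//; case: hasP => // -[]; exists c => //; rewrite c1.
  rewrite ltn_addl//; case: hasP => // -[]; exists c => //.
  by rewrite /new cA c1.
rewrite meanD lerD//; first by rewrite sub//; exact: covered_periodic.
rewrite -meanZ.
rewrite (eq_mean _ _ _ (fun x => w x * (g x * (B x)%:R))); last first.
  by move=> x; rewrite mulrA.
rewrite mean_fibre//; apply: le_mean => x.
rewrite [leRHS]mulrCA ler_wpM2l//; apply: (le_trans (fibre_gB x)).
by rewrite ler_pM2l// ler_pXn2r// ?nnegrE//; exact: le_trans (alpha_le x).
Qed.

End Step.

Section Multiplicity.
Variable s : R.
Hypothesis mult_le : forall n, (count (fun c => c.1 == n) cs)%:R <= s.

Lemma sum_moduli_le (D : seq nat) (F : nat -> R) : uniq D -> (forall n, 0 <= F n) ->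
  \sum_(c <- cs | c.1 \in D) F c.1 <= s * \sum_(n <- D) F n.
Proof.
move=> uD F0.
rewrite (eq_bigr (fun c => \sum_(n <- D) (c.1 == n)%:R * F n)); last first.
  move=> c cD; rewrite (bigD1_seq c.1)//= eqxx mul1r big1 ?addr0// => n.
  by rewrite eq_sym => /negbTE ->; rewrite mul0r.
rewrite exchange_big/= mulr_sumr; apply: ler_sum => n _.
rewrite -mulr_suml ler_wpM2r//; apply: le_trans (mult_le n).
rewrite -sum1_count natr_sum big_mkcond [leRHS]big_mkcond/=; apply: ler_sum => c _.
by case: ifP => _; case: ifP.
Qed.

Lemma sum_moduli_pfactor_le (A p e : nat) (H : nat -> R) :
  (0 < A)%N -> prime p -> coprime A p -> (forall n, 0 <= H n) ->
  \sum_(c <- [seq c <- cs | (c.1 %| A * p ^ e)%N && ~~ (c.1 %| A)%N]) H c.1 <=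
  s * \sum_(m <- divisors A) \sum_(1 <= j < e.+1) H (m * p ^ j)%N.
Proof.
move=> A0 pp cAp H0; have s0 : 0 <= s by apply: le_trans (mult_le 0).
(* Vanishing on the divisors of [A] removes the exponent j = 0. *)
pose F n := if (n %| A)%N then 0 else H n.
have F0 n : 0 <= F n by rewrite /F; case: ifP.
have AP0 : (0 < A * p ^ e)%N by rewrite muln_gt0 A0 expn_gt0 prime_gt0.
rewrite big_filter (eq_bigr (fun c => F c.1)); last first.
  by move=> c /andP[_ /negbTE cA]; rewrite /F cA.
apply: (@le_trans _ _ (\sum_(c <- cs | c.1 \in divisors (A * p ^ e)) F c.1)).
  rewrite big_mkcond [leRHS]big_mkcond/=; apply: ler_sum => c _.
  by rewrite -dvdn_divisors//; case: (c.1 %| _)%N => //=; case: ifP.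
apply: (le_trans (sum_moduli_le _ _ (divisors_uniq _) F0)).
rewrite ler_wpM2l// divisor_sum_mul_pfactor// big_seq [leRHS]big_seq.
apply: ler_sum => m; rewrite -dvdn_divisors// => mA.
rewrite big_ltn// {1}/F expn0 muln1 mA add0r; apply: ler_sum => j _.
by rewrite /F; case: ifP.
Qed.

Lemma sum_invX_le p e : (1 < p)%N ->
  \sum_(1 <= j < e.+1) (p%:R ^+ j)^-1 <= 2 / p%:R :> R.
Proof.
move=> p1; have pR : (2 : R) <= p%:R by rewrite ler_nat.
suff : \sum_(1 <= j < e.+1) (p%:R ^+ j)^-1 <= 2 / p%:R - 2 / p%:R ^+ e.+1 :> R.
  move=> /le_trans; apply; rewrite lerBlDr lerDl divr_ge0// exprn_ge0//; lra.
elim: e => [|e IH]; first by rewrite big_geq// expr1 subrr.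
rewrite big_nat_recr//=; apply: (le_trans (lerD IH (lexx _))).
rewrite -addrA lerD2l -lerBrDl.
have q0 : (0 : R) < p%:R ^+ e.+1 by rewrite exprn_gt0//; lra.
have -> : 2 / p%:R ^+ e.+2 = (2 / p%:R) * (p%:R ^+ e.+1)^-1 :> R.
  by rewrite exprS invfM mulrA.
have h : 2 / p%:R <= 1 :> R by rewrite ler_pdivrMr; lra.
have : (0 : R) < (p%:R ^+ e.+1)^-1 by rewrite invr_gt0.
by nra.
Qed.

(** Expanding the square, each pair of classes contributes its powers of 1/p times at most the
    weight of the lcm of the parts prime to [p]. Passing from classes to moduli costs [s] twice, and
    the powers of 1/p sum to at most (2/p)^2. *)
Lemma second_moment_le (A p e : nat) w eps : (0 < A)%N -> prime p -> coprime A p ->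
  distorted A w eps ->
  mean R A (fun x => w x * (\sum_(c <- [seq c <- cs |
    (c.1 %| A * p ^ e)%N && ~~ (c.1 %| A)%N]) (p%:R ^+ logn p c.1)^-1 *
     (x == c.2 %[mod c.1 %/ p ^ logn p c.1])%:R) ^+ 2) <=
  s ^+ 2 * (2 / p%:R) ^+ 2 * lcm_weight R A.
Proof.
move=> A0 pp cAp dw; set new := [seq c <- cs | _].
have s0 : 0 <= s by apply: le_trans (mult_le 0).
pose u n : R := (p%:R ^+ logn p n)^-1.
pose m n := (n %/ p ^ logn p n)%N.
have u0 n : 0 <= u n by rewrite invr_ge0 exprn_ge0.
have E1 k j : (k %| A)%N -> logn p (k * p ^ j) = j.
  move=> kA; rewrite lognM ?(dvdn_gt0 A0 kA) ?expn_gt0 ?prime_gt0// pfactorK//.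
  by rewrite logn_coprime// coprime_sym (coprime_dvdl kA).
have E2 k j : (k %| A)%N -> m (k * p ^ j)%N = k.
  by move=> kA; rewrite /m E1// mulnK// expn_gt0 prime_gt0.
have newA c : c \in new -> (m c.1 %| A)%N.
  rewrite mem_filter => /andP[/andP[cA _] _].
  move: cA; rewrite dvdn_divisors ?muln_gt0 ?A0 ?expn_gt0 ?prime_gt0//.
  rewrite (perm_mem (perm_divisors_mul_pfactor _ _ e A0 pp cAp)).
  case/allpairsP => -[k j] [kA _ ->]; move: kA; rewrite -dvdn_divisors// => kA.
  by rewrite E2.
pose F a b := u a * u b * weight R (lcmn (m a) (m b)).
have F0 a b : 0 <= F a b by rewrite mulr_ge0 ?weight_ge0// mulr_ge0.
apply: (@le_trans _ _ (\sum_(c <- new) \sum_(d <- new) F c.1 d.1)).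
  rewrite (eq_mean _ _ _ (fun x => \sum_(c <- new) \sum_(d <- new)
     u c.1 * u d.1 * (w x * ((x == c.2 %[mod m c.1])%:R * (x == d.2 %[mod m d.1])%:R)))).
    rewrite mean_sum big_seq [leRHS]big_seq; apply: ler_sum => c cn.
    rewrite mean_sum big_seq [leRHS]big_seq; apply: ler_sum => d dn.
    rewrite meanZ ler_wpM2l ?mulr_ge0//.
    by apply: mean_le_distorted_eqmod2; [exact: dw|exact: newA|exact: newA].
  move=> x; rewrite expr2 big_distrl/= big_distrr/=; apply: eq_bigr => c _.
  rewrite !big_distrr/=; apply: eq_bigr => d _; rewrite /u /m; ring.
apply: (@le_trans _ _ (\sum_(c <- new) (s * \sum_(k <- divisors A)
    \sum_(1 <= j < e.+1) F c.1 (k * p ^ j)%N))).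
  by apply: ler_sum => c _; exact: sum_moduli_pfactor_le.
rewrite -mulr_sumr (_ : s ^+ 2 * _ * _ =
  s * (s * ((2 / p%:R) ^+ 2 * lcm_weight R A))); last by ring.
rewrite ler_wpM2l//.
pose H a := \sum_(k <- divisors A) \sum_(1 <= j < e.+1) F a (k * p ^ j)%N.
apply: (le_trans (sum_moduli_pfactor_le _ _ e H A0 pp cAp _)).
  by move=> a; do 2!apply: sumr_ge0 => ? _.
rewrite ler_wpM2l// /H /lcm_weight big_distrr/= big_seq [leRHS]big_seq.
apply: ler_sum => k1; rewrite -dvdn_divisors// => k1A.
rewrite exchange_big/= big_distrr/= big_seq [leRHS]big_seq.
apply: ler_sum => k2; rewrite -dvdn_divisors// => k2A.
pose S : R := \sum_(1 <= j < e.+1) (p%:R ^+ j)^-1.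
rewrite (_ : \sum_(_ <= _ < _) _ = S ^+ 2 * weight R (lcmn k1 k2)); last first.
  rewrite expr2 -mulrA {1}/S big_distrl/=; apply: eq_bigr => i _.
  rewrite /S big_distrl big_distrr/=; apply: eq_bigr => j _.
  by rewrite /F /u !E1// !E2// mulrA.
rewrite ler_wpM2r ?weight_ge0// ler_pXn2r// ?nnegrE ?divr_ge0//.
  by apply: sum_invX_le; exact: prime_gt1.
by apply: sumr_ge0 => j _; rewrite invr_ge0 exprn_ge0.
Qed.
End Multiplicity.
End Distortion.

(** * Existence of an uncovered integer *)

Section Core.
Variable R : realType.

(** Lets losses of order y^(-1 - theta) be summed by telescoping; it follows from exp u >= 1 + u and
    ln(y + 1) - ln y >= 1/(y + 1). *)
Lemma powR_telescope (theta : R) y : 0 <= theta -> (0 < y)%N ->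
  theta * y.+1%:R `^ (- theta) / y.+1%:R <= y%:R `^ (- theta) - y.+1%:R `^ (- theta).
Proof.
move=> t0 y0.
have -> : y%:R `^ (- theta) =
    y.+1%:R `^ (- theta) * expR (theta * (ln y.+1%:R - ln y%:R)).
  rewrite /powR !pnatr_eq0 (gtn_eqF y0)/= -expRD; congr expR; ring.
rewrite -[X in _ <= _ - X]mulr1 -mulrBr [theta * _]mulrC -mulrA.
rewrite ler_wpM2l ?powR_ge0// lerBrDl; apply: le_trans (expR_ge1Dx _).
by rewrite lerD2l ler_wpM2l// invS_le_lnB.
Qed.

Section Fixed.
Variables (cs : seq (nat * nat)) (s : R).
Hypothesis mult_le : forall n, (count (fun c => c.1 == n) cs)%:R <= s.
Variables (C del : R).
Hypothesis (C0 : 0 <= C) (del0 : 0 <= del) (del1 : del < 1).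
Hypothesis recip_le : forall y, (0 < y)%N ->
  expR (20 * prime_recip R y) <= C * y%:R `^ del.

Let s0 : 0 <= s. Proof. exact: le_trans (mult_le 0). Qed.

Lemma distorted_weaken A w (eps eps' : R) : eps <= eps' ->
  distorted R cs A w eps -> distorted R cs A w eps'.
Proof. by move=> e [? ? ? ? h]; split => //; exact: le_trans h e. Qed.

(** A prime p costs at most 2 s^2 (2/p)^2 C p^del = 8 s^2 C p^(del - 2), which telescopes with theta
    = 1 - del. At a non-prime the modulus and the weight stay the same. *)
Lemma distorted_smooth_modulus e K y eps w : (0 < K <= y)%N ->
  distorted R cs (smooth_modulus e K) w eps ->
  exists w', distorted R cs (smooth_modulus e y) w' (eps +
    8 * s ^+ 2 * C / (1 - del) *
    (K%:R `^ (- (1 - del)) - y%:R `^ (- (1 - del)))).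
Proof.
move=> /andP[K0 Ky] dw; move: Ky => /subnK <-.
elim: (y - K)%N => [|n [v IH]].
  by exists w; rewrite add0n subrr mulr0 addr0.
rewrite addSn; move: (n + K)%N (leq_addl n K) IH => z Kz IH.
have z0 : (0 < z)%N by exact: leq_trans Kz.
pose a : R := 8 * s ^+ 2 * C / (1 - del).
have a0 : 0 <= a by rewrite divr_ge0 ?(mulr_ge0, exprn_ge0)// subr_ge0 ltW.
have d1 : 0 <= 1 - del by rewrite subr_ge0 ltW.
have tel := powR_telescope _ _ d1 z0.
have pz0 : 0 <= z.+1%:R `^ (- (1 - del)) by exact: powR_ge0.
rewrite smooth_modulusS; case: ifP => [pp|_]; last first.
  exists v; apply: distorted_weaken IH.
  rewrite lerD2l ler_wpM2l// lerD2l lerN2 -subr_ge0.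
  by apply: le_trans tel; rewrite !mulr_ge0// invr_ge0.
have A0 := smooth_modulus_gt0 e z.
have cAp := coprime_smooth_modulus e z z.+1 pp (ltnSn z).
have [w2 dw2] := distortion_step _ _ _ z.+1 e _ _ A0 pp cAp IH.
exists w2; apply: distorted_weaken dw2.
have m2 := second_moment_le _ _ _ mult_le _ z.+1 e _ _ A0 pp cAp IH.
rewrite -addrA lerD2l -/a.
have -> : a * (K%:R `^ (- (1 - del)) - z.+1%:R `^ (- (1 - del))) =
  a * (K%:R `^ (- (1 - del)) - z%:R `^ (- (1 - del))) +
  a * (z%:R `^ (- (1 - del)) - z.+1%:R `^ (- (1 - del))) by ring.
rewrite lerD2l; apply: (@le_trans _ _ (2 * (s ^+ 2 * (2 / z.+1%:R) ^+ 2 * (C * z.+1%:R `^ del)))).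
  rewrite ler_pM2l//; apply: (le_trans m2); rewrite ler_wpM2l//.
    by rewrite mulr_ge0// exprn_ge0// divr_ge0.
  apply: (le_trans (lcm_weight_smooth_modulus _ _ _)).
  apply: (le_trans (recip_le _ z0)); rewrite ler_wpM2l//.
  by apply: ge0_ler_powR; rewrite ?nnegrE// ler_nat.
apply: (@le_trans _ _ (a * ((1 - del) * z.+1%:R `^ (- (1 - del)) / z.+1%:R))); last first.
  by rewrite ler_wpM2l.
have -> : z.+1%:R `^ (- (1 - del)) = z.+1%:R `^ del / z.+1%:R :> R.
  rewrite opprB powRB ?powRr1//; apply/implyP => _; apply/implyP.
  by rewrite pnatr_eq0.
have zR : (0 : R) < z.+1%:R by rewrite ltr0n.
rewrite le_eqVlt; apply/orP; left; apply/eqP; rewrite /a; field.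
by rewrite -natr1 addrC in zR; rewrite !lt0r_neq0// subr_gt0.
Qed.

Variables (N eta T : R) (K : nat).
Hypotheses (K0 : (0 < K)%N) (N0 : 0 < N) (eta0 : 0 <= eta) (eta1 : eta <= 1 / 2).
Hypothesis T_ge : forall p, prime p -> (p <= K)%N -> p%:R `^ eta <= T.
Hypothesis cs_gt : forall c, c \in cs -> N < c.1%:R.

(** Rankin's trick: N < n gives 1/n <= N^(-eta) n^(eta - 1), and the sum may then run over all
    divisors. *)
Lemma smooth_part_le e :
  \sum_(c <- cs | (c.1 %| smooth_modulus e K)%N) c.1%:R^-1 <=
  s * (N `^ (- eta) * expR (4 * T * prime_recip R K)).
Proof.
have A0 := smooth_modulus_gt0 e K.
pose F n : R := N `^ (- eta) * n%:R `^ (- (1 - eta)).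
have F0 n : 0 <= F n by rewrite mulr_ge0 ?powR_ge0.
apply: (@le_trans _ _ (\sum_(c <- cs | c.1 \in divisors (smooth_modulus e K)) F c.1)).
  rewrite big_seq_cond [leRHS]big_seq_cond.
  rewrite (eq_bigl (fun c => (c \in cs) && (c.1 \in divisors (smooth_modulus e K)))); last first.
    by move=> c; rewrite -dvdn_divisors.
  apply: ler_sum => c /andP[/cs_gt Nc _].
  have c0 : (0 : R) < c.1%:R by exact: lt_trans Nc.
  rewrite /F opprB powRB; last first.
    by apply/implyP => _; apply/implyP; rewrite gt_eqF.
  have c0' := ltW c0.
  rewrite powRr1// mulrA -[leLHS]mul1r ler_wpM2r ?invr_ge0//.
  rewrite powRN mulrC ler_pdivlMr ?powR_gt0// mul1r.
  by apply: ge0_ler_powR; rewrite ?nnegrE//; exact: ltW.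
apply: (le_trans (sum_moduli_le _ _ _ mult_le _ F (divisors_uniq _) F0)).
rewrite ler_wpM2l// /F -mulr_sumr ler_wpM2l ?powR_ge0//.
apply: smooth_powR_sum; first by have := eta1; lra.
by move=> p pp pK; rewrite opprB addrC subrK T_ge.
Qed.

(** If every integer were hit, the total mass 1 would be covered, yet the covered mass is at most
    the smooth part plus the losses at the primes above [K]. *)
Lemma exists_not_hit :
  s * (N `^ (- eta) * expR (4 * T * prime_recip R K)) +
    8 * s ^+ 2 * C / (1 - del) * K%:R `^ (- (1 - del)) < 1 ->
  exists x, forall c, c \in cs -> ~~ hit c x.
Proof.
move=> lt1.
(* Large enough to exceed [K] weakly and to bound every modulus, so that all moduli divide
   [smooth_modulus e e]. *)
pose e := (K + \max_(c <- cs) c.1)%N.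
have A0 := smooth_modulus_gt0 e K.
have := distorted_weaken _ _ _ _ (smooth_part_le e) (distorted_cst R cs _ A0).
have Ke : (0 < K <= e)%N by rewrite K0 leq_addr.
move=> /(distorted_smooth_modulus _ _ _ _ _ Ke)[w [_ _ w1 _ bad]].
apply: contrapT => no; move: lt1; apply/negP; rewrite -leNgt.
have cov x : covered cs (smooth_modulus e e) x.
  apply/hasP; apply: contrapT => nc; apply: no; exists x => c cC.
  apply/negP => hc; apply: nc; exists c => //; rewrite hc andbT.
  apply: dvdn_smooth_modulus; apply/andP; split.
    by rewrite -(@ltr0n R) (lt_trans N0)// cs_gt.
  by rewrite /e (leq_trans _ (leq_addl _ _))// (leq_bigmax_seq c).
rewrite -[leLHS]w1.
apply: (@le_trans _ _ (mean R (smooth_modulus e e) (fun x => w x * (covered cs (smooth_modulus e e) x)%:R))).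
  by apply: le_mean => x; rewrite cov mulr1.
apply: (le_trans bad); rewrite lerD2l ler_wpM2l//.
  by rewrite divr_ge0 ?(mulr_ge0, exprn_ge0)// subr_ge0 ltW.
by rewrite gerBl powR_ge0.
Qed.
End Fixed.
End Core.

(** * Positivity of the density *)

(** The whole class of [m0] modulo the product [L] of the moduli is uncovered, and each block of [L]
    consecutive integers meets it. *)
Lemma delta_gt0 (R : realType) (C : {fset nat * nat}) (m0 : int) :
  residue_system C -> uncovered C m0 -> 0 < delta R C.
Proof.
move=> C_pos Um0; set A := uncovered C in Um0 *.
pose L := (\prod_(p <- C) p.1)%N.
have L0 : (0 < L)%N by rewrite /L big_seq prodn_cond_gt0// => p /C_pos[].
have U_eq m : (m = m0 %[mod L%:Z])%Z -> A m.
  move=> mE p pC; apply: contra (Um0 p pC) => /eqP mp.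
  suff E : (m0 = m %[mod p.1%:Z])%Z by rewrite E mp.
  apply/eqP; rewrite eqz_mod_dvd; apply: (@dvdz_trans L%:Z).
    by rewrite /L (big_fsetD1 p)//= PoszM dvdz_mulr.
  by rewrite -eqz_mod_dvd; apply/eqP.
have card_ge n : (n.*2.+1 %/ L <= #|` fset_set (A `&` `[(- n%:Z), n%:Z])%classic |)%N.
  rewrite card_window.
  pose a k : nat := `[< A (k%:Z - n%:Z) >].
  have blocks q : (q <= \sum_(0 <= k < q * L) a k)%N.
    elim: q => [//|q IH]; rewrite mulSn addnC (big_cat_nat (n := (q * L)%N)) ?leq_addr//=.
    rewrite -[q.+1]addn1 leq_add//.
    (* The offset in the block at which k - n is congruent to [m0] modulo [L]. *)
    pose r := absz ((m0 + n%:Z - (q * L)%N%:Z) %% L%:Z)%Z.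
    have L0Z : L%:Z != 0 by rewrite eqz_nat -lt0n.
    have rE : (r%:Z = (m0 + n%:Z - (q * L)%N%:Z) %% L%:Z)%Z.
      by rewrite gez0_abs// modz_ge0.
    have rL : (r < L)%N.
      by rewrite -ltz_nat rE (@lt_le_trans _ _ `|L%:Z|)// ltz_mod.
    have ar : a (q * L + r)%N = 1%N.
      rewrite /a; case: asboolP => // na; case: na; apply: U_eq.
      apply/eqP; rewrite eqz_mod_dvd PoszD rE.
      set z := m0 + n%:Z - (q * L)%N%:Z.
      rewrite (_ : _ - m0 = - ((z %/ L%:Z)%Z * L%:Z)).
        by rewrite rpredN dvdz_mull.
      by have := divz_eq z L%:Z; rewrite /z; lia.
    rewrite (big_cat_nat (n := (q * L + r)%N)) ?leq_addr ?leq_add2l ?(ltnW rL)//=.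
    by rewrite [X in (_ <= _ + X)%N]big_ltn ?ltn_add2l// ar addnCA leq_addr.
  apply: (leq_trans (blocks _)).
  rewrite [leqRHS](big_cat_nat (n := (n.*2.+1 %/ L * L)%N)) ?leq_divM//=.
  exact: leq_addr.
have LR : (0 : R) < L%:R by rewrite ltr0n.
(* A window of M >= L integers has at least M / (2L) complete blocks; the 2 absorbs the rounding. *)
apply: (@lt_le_trans _ _ (1 / (2 * L%:R))); first by rewrite divr_gt0// mulr_gt0.
apply: limr_ge; first exact: cvg_density_uncovered.
exists L => // n /= Ln.
rewrite /density_seq ler_pdivlMr ?ltr0n// mulrC mulrA mulr1 ler_pdivrMr ?mulr_gt0//.
rewrite -!natrM ler_nat; apply: leq_trans (leq_mul (card_ge n) (leqnn _)).
have := divn_eq n.*2.+1 L; have := ltn_pmod n.*2.+1 L0.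
set q := (_ %/ _)%N; set t := (_ %% _)%N; rewrite -addnn => tL E.
have q1 : (0 < q)%N by rewrite /q divn_gt0// -addnn; lia.
by rewrite E; nia.
Qed.

(** * Numerical bounds for the two losses *)

Lemma linear_le_expR (R : realType) (a tau l : R) : 0 < tau -> 0 <= a -> 1 <= l ->
  8 * a / tau ^+ 2 <= l -> a * (1 + l) <= expR (tau * l).
Proof.
move=> t0 a0 l1 al.
(* Squaring this gives quadratic growth, tau^2 l^2 / 4; the 8 in the hypothesis is this 4 times the
   2 of 1 + l <= 2l. *)
have h : 1 + tau * l / 2 <= expR (tau * l / 2) by exact: expR_ge1Dx.
have -> : tau * l = tau * l / 2 * 2%:R by field.
rewrite expRM_natr; apply: (@le_trans _ _ ((tau * l / 2) ^+ 2)).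
  move: al; rewrite ler_pdivrMr ?exprn_gt0// => al.
  have := mulr_ge0 a0 (le_trans ler01 l1); nra.
rewrite ler_pXn2r ?nnegrE ?expR_ge0//; first by apply: le_trans h; lra.
by rewrite divr_ge0// mulr_ge0//; lra.
Qed.

Lemma prime_recip_powR (R : realType) (del : R) : 0 < del ->
  exists2 C, 0 <= C & forall y, (0 < y)%N ->
    expR (20 * prime_recip R y) <= C * y%:R `^ del.
Proof.
move=> d0; have [|K HK] := prime_recip_le_ln R (del / 20); first by rewrite divr_gt0.
exists (expR (20 * K)) => [|y y0]; first exact: expR_ge0.
rewrite /powR pnatr_eq0 gtn_eqF// -expRD ler_expR.
by have := HK y y0; lra.
Qed.

(** Here l stands for loglog N, so that exp l is log N. *)
Lemma sqrt_mul_expR_bounds (R : realType) (l : R) : 1 <= l ->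
  let X := Num.sqrt (expR l * l) in
  [/\ X ^+ 2 = expR l * l, expR (l / 2) <= X, X <= expR l & l <= X].
Proof.
move=> l1 X; have l0 : 0 <= l by lra.
have X0 : 0 <= X by exact: sqrtr_ge0.
have XE : X ^+ 2 = expR l * l by rewrite sqr_sqrtr// mulr_ge0 ?expR_ge0.
have el : l <= expR l by have := expR_ge1Dx l; lra.
split => //; rewrite -(@ler_pXn2r _ 2) ?nnegrE ?expR_ge0// XE.
- by rewrite -expRM_natr divfK ?pnatr_eq0// ler_peMr ?expR_ge0.
- by rewrite expr2 ler_wpM2l ?expR_ge0.
- by rewrite expr2 ler_wpM2r.
Qed.

(* The two exponents differ by [tau X], which dominates the Rankin product
   because [X >= exp (l / 2) = exp (kappa l) exp (tau l)]. *)
Lemma rankin_bound_small (R : realType) (kappa tau l X r : R) :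
  0 <= kappa -> 0 < tau -> kappa + tau = 1 / 2 -> 1 <= l -> 224 / tau ^+ 3 <= l ->
  expR (l / 2) <= X -> r <= 5 / 2 + 2 * (l + 2) ->
  expR ((kappa - tau) * X) * (expR (- (kappa * X)) * expR (4 * expR (kappa * l) * r))
  <= 1 / 3.
Proof.
move=> k0 t0 kt l1 l2 lX rl; set T := expR (kappa * l).
have T1 : 1 <= T by rewrite /T -expR0 ler_expR mulr_ge0//; lra.
(* The Rankin exponent 4 T r is at most T (26 + 8 l); with 28 the total exponent is at most -2, and
   exp 2 >= 3. *)
have h : 28 * (1 + l) <= expR (tau * l) * tau.
  rewrite -ler_pdivrMr// mulrAC; apply: linear_le_expR => //.
    by rewrite divr_ge0// ltW.
  by rewrite (_ : 8 * _ / _ = 224 / tau ^+ 3)//; field; exact: lt0r_neq0.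
have TX : T * expR (tau * l) <= X.
  by rewrite /T -expRD -mulrDl kt mul1r mulrC.
have hX : 28 * (1 + l) * T <= tau * X.
  apply: le_trans (ler_wpM2l (ltW t0) TX).
  rewrite (_ : tau * (T * _) = expR (tau * l) * tau * T); last by ring.
  by rewrite ler_wpM2r//; exact: le_trans T1.
have rT : 4 * T * r <= 4 * T * (5 / 2 + 2 * (l + 2)) by rewrite ler_wpM2l//; lra.
apply: (@le_trans _ _ (expR (- 2))).
  have Tl : 0 <= T * l by rewrite mulr_ge0//; lra.
  by rewrite -!expRD ler_expR; lra.
rewrite expRN div1r lef_pV2 ?posrE ?expR_gt0//.
by have := expR_ge1Dx (2 : R); lra.
Qed.

(** Here k is e^X rounded down. The bounds for s^2 and k^(-(1 - del)) multiply to a constant times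
    e^(-del X); the constant is 8 * 2 * 2 * C = 32 C, whence 96 C for the bound 1/3. *)
Lemma large_prime_bound_small (R : realType) (del X C k s : R) :
  0 < del -> del < 1 / 2 -> 0 <= C -> 96 * C <= del * X ->
  1 <= k -> expR X < k + 1 -> 0 <= s -> s ^+ 2 <= expR ((1 - 2 * del) * X) ->
  8 * s ^+ 2 * C / (1 - del) * k `^ (- (1 - del)) <= 1 / 3.
Proof.
move=> d0 d1 C0 CX k1 Xk s0 s2.
(* The factor 2 pays for the rounding: e^X < k + 1 <= 2k. *)
have kd : k `^ (- (1 - del)) <= 2 * expR (- (1 - del) * X).
  have k0 : 0 < k by lra.
  rewrite /powR gt_eqF//.
  have ln2 : 0 <= ln 2 :> R by rewrite ln_ge0//; lra.
  have XK : X <= ln 2 + ln k.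
    rewrite -lnM ?posrE// -[leLHS]expRK ler_ln ?posrE ?expR_gt0 ?mulr_gt0//; lra.
  rewrite -[X in _ <= X * _](@lnK _ 2) ?posrE// -expRD ler_expR.
  clear - XK ln2 d0 d1; nra.
have inv2 : (1 - del)^-1 <= 2.
  by rewrite -[leRHS]invrK lef_pV2 ?posrE ?invr_gt0//; lra.
have i0 : 0 <= (1 - del)^-1 by rewrite invr_ge0; lra.
have big : 96 * C <= expR (del * X) by have := expR_ge1Dx (del * X); lra.
apply: (@le_trans _ _ (8 * expR ((1 - 2 * del) * X) * C * 2 *
    (2 * expR (- (1 - del) * X)))).
  apply: ler_pM => //; rewrite ?powR_ge0//.
    by rewrite mulr_ge0// mulr_ge0// mulr_ge0// exprn_ge0.
  apply: ler_pM => //; first by rewrite mulr_ge0// mulr_ge0// exprn_ge0.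
  by rewrite ler_wpM2r// ler_pM2l.
rewrite (_ : _ * _ = 32 * C * (expR ((1 - 2 * del) * X) * expR (- (1 - del) * X)));
  last by ring.
rewrite -expRD (_ : _ + _ = - (del * X)); last by ring.
by rewrite expRN ler_pdivrMr ?expR_gt0//; lra.
Qed.

(** * Choice of the parameters *)

Theorem theorem2 (R : realType) (b c : R)
    (hb0 : 0 < b) (hb : b < 1 / 2)
    (hc0 : 0 < c) (hc : c < 1 / 3 * (1 - 4 * b ^+ 2)) :
  exists N0 : R, forall N s : R, N0 <= N -> 1 <= s ->
    s <= expR (b * Num.sqrt (ln N * ln (ln N))) ->
    forall C : {fset nat * nat}, residue_system C ->
      (forall n : nat, n \in moduli C -> N < n%:R) ->
      (forall n : nat, n \in moduli C -> (moduli C n)%:R <= s) ->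
      \sum_(n <- moduli C) (n%:R)^-1 <= c * ln (Lfun N s) ->
      0 < delta R C.
Proof.
(* [kappa] is the midpoint of b and 1/2, so kappa - tau = b and kappa + tau = 1/2. Moreover 1 - 2
   del = 2b, the exponent of the bound for s^2. *)
pose tau : R := (1 / 2 - b) / 2; pose kappa : R := (b + 1 / 2) / 2.
pose del : R := (1 - 2 * b) / 2.
have t0 : 0 < tau by rewrite /tau; lra.
have k0 : 0 < kappa by rewrite /kappa; lra.
have d0 : 0 < del by rewrite /del; lra.
have d1 : del < 1 / 2 by rewrite /del; lra.
have [K1 K10 recip_le] := prime_recip_powR R del d0.
(* The summands secure, in turn, l >= 1, the threshold of the Rankin bound, and 96 K1 <= del X by
   way of l <= X. *)
pose l0 := 1 + 224 / tau ^+ 3 + 96 * K1 / del.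
have p1 : 0 <= 224 / tau ^+ 3 by rewrite divr_ge0// exprn_ge0// ltW.
have p2 : 0 <= 96 * K1 / del by rewrite divr_ge0 ?(ltW d0)// mulr_ge0.
exists (expR (expR l0)) => N s NN s1 s_le C C_pos C_gt C_mult _.
have N0 : 0 < N by apply: lt_le_trans NN; exact: expR_gt0.
have lnN : expR l0 <= ln N by rewrite -[leLHS]expRK ler_ln ?posrE ?expR_gt0.
have lnN0 : 0 < ln N by apply: lt_le_trans lnN; exact: expR_gt0.
pose l := ln (ln N).
have ll : l0 <= l by rewrite -[leLHS]expRK ler_ln ?posrE ?expR_gt0.
have lnNE : ln N = expR l by rewrite lnK// posrE.
have l1 : 1 <= l by move: ll; rewrite /l0; lra.
have l2 : 224 / tau ^+ 3 <= l by move: ll; rewrite /l0; lra.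
have l3 : 96 * K1 / del <= l by move: ll; rewrite /l0; lra.
move: s_le; rewrite -/l lnNE; set X := Num.sqrt _ => s_le.
have [XE X_half X_le l_X] := sqrt_mul_expR_bounds R l l1; rewrite -/X in XE X_half X_le l_X.
have X0 : 0 < X by apply: lt_le_trans l_X; lra.
pose K := Num.truncn (expR X).
have K0 : (0 < K)%N by rewrite truncn_gt0 ltW// expR_gt1.
have K_le : K%:R <= expR X by rewrite truncn_le expR_ge0.
have K_gt : expR X < K%:R + 1 by rewrite natr1 truncnS_gt.
have K1R : (1 : R) <= K%:R by rewrite ler1n.
have lnX m : (0 < m <= K)%N -> ln m%:R <= X.
  move=> /andP[m0 mK]; rewrite -[leRHS]expRK ler_ln ?posrE ?expR_gt0 ?ltr0n//.
  by apply: le_trans K_le; rewrite ler_nat.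
(* Chosen so that e^(eta X) = (log N)^kappa, while N^eta = e^(kappa X) because X^2 = l log N. *)
pose eta := kappa * l / X.
have etaX : eta * X = kappa * l by rewrite divfK// gt_eqF.
have eta0 : 0 <= eta by rewrite divr_ge0 ?(ltW X0)// mulr_ge0 ?(ltW k0)//; lra.
have eta1 : eta <= 1 / 2.
  rewrite ler_pdivrMr// ler_pM//; rewrite ?(ltW k0)//; first by lra.
  by rewrite /kappa; lra.
have T_ge p : prime p -> (p <= K)%N -> p%:R `^ eta <= expR (kappa * l).
  move=> pp pK; rewrite /powR pnatr_eq0 gtn_eqF ?prime_gt0// ler_expR -etaX.
  by rewrite ler_wpM2l// lnX// prime_gt0.
pose cs : seq (nat * nat) := C.
have memE n : (n \in moduli C) = (n \in [seq p.1 | p <- cs]).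
  by rewrite /moduli; apply/perm_mem/perm_eq_seq_mset.
have mult_le n : (count (fun q => q.1 == n) cs)%:R <= s.
  have cE : count (fun q => q.1 == n) cs = moduli C n.
    by rewrite /moduli mset_seqE count_map.
  (* The multiplicity bound is given for actual moduli; any other count is 0. *)
  have [nC|nC] := boolP (n \in moduli C); first by rewrite cE C_mult.
  rewrite (_ : count _ _ = 0%N); first exact: le_trans s1.
  have := nC; rewrite memE => /count_memPn; rewrite count_map => <-.
  exact: eq_count.
have cs_gt q : q \in cs -> N < q.1%:R by move=> qC; rewrite C_gt// memE map_f.
have small : s * (N `^ (- eta) * expR (4 * expR (kappa * l) * prime_recip R K)) <= 1 / 3.
  have -> : N `^ (- eta) = expR (- (kappa * X)).
    rewrite /powR gt_eqF//; congr expR; rewrite lnNE mulNr; congr (- _).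
    apply: (mulIf (lt0r_neq0 X0)); rewrite mulrAC etaX -[RHS]mulrA -expr2 XE.
    by rewrite -mulrA [l * _]mulrC.
  apply: le_trans (rankin_bound_small R kappa tau l X (prime_recip R K) _ _ _ _ _ _ _) => //.
  - rewrite ler_wpM2r ?mulr_ge0 ?expR_ge0//; apply: (le_trans s_le).
    by rewrite ler_expR (_ : b = kappa - tau)// /kappa /tau; lra.
  - exact: ltW.
  - by rewrite /kappa /tau; lra.
  (* As X <= e^l, 1 + 2 ln K <= 3 e^l <= e^(l + 2). *)
  apply: (le_trans (prime_recip_le_lnln R K K0)); rewrite lerD2l ler_pM2l//.
  have lK : ln K%:R <= X by rewrite lnX// K0 leqnn.
  have lK0 : (0 : R) <= ln K%:R by rewrite ln_ge0.
  rewrite -[leRHS]expRK ler_ln ?posrE ?expR_gt0//; last by lra.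
  have := expR_ge1Dx (2 : R); have := expR_ge1Dx l; rewrite expRD.
  move: (expR l) (expR 2) X_le => u v X_le; nra.
have large : 8 * s ^+ 2 * K1 / (1 - del) * K%:R `^ (- (1 - del)) <= 1 / 3.
  apply: (large_prime_bound_small R del X) => //.
  - by move: l3; rewrite ler_pdivrMr// => /le_trans; apply; rewrite mulrC ler_pM2l.
  - exact: le_trans s1.
  rewrite (_ : 1 - 2 * del = b * 2%:R); last by rewrite /del; lra.
  rewrite mulrAC expRM_natr ler_pXn2r ?nnegrE ?expR_ge0//.
  exact: le_trans s1.
have [||x hx] := exists_not_hit R cs s mult_le K1 del K10 (ltW d0) _ recip_le N eta _ K
  K0 N0 eta0 eta1 T_ge cs_gt.
- by lra.
- by apply: (le_lt_trans (lerD small large)); lra.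
apply: (@delta_gt0 _ _ x%:Z C_pos) => q qC.
by have := hx q qC; rewrite /hit !modz_nat eqz_nat.
Qed.
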